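(* Given $k\in\mathbb N$, there exist a finite number $N(k)$ and a set of complete $k$-dimensional cone fans $$\{\mathcal C^k_1,\mathcal C^k_2,\ldots,\mathcal C^k_{N(k)}\}$$ such that for every $d$, every $d$-dimensional parallelohedron $P$, and every $(d-k)$-dimensional face $F$ of the tiling $\mathcal T(P)$, the fan $\mathrm{Fan}(F)$ is (combinatorially) isomorphic to some $\mathcal C^k_i$, $1\le i\le N(k)$.
   Context: A $d$-dimensional parallelohedron is a convex $d$-dimensional polytope $P\subset\mathbb R^d$ that admits a face-to-face tiling $\mathcal T(P)$ of $\mathbb R^d$ by translates of $P$: the translates cover $\mathbb R^d$, have pairwise disjoint interiors, and any two of them are either disjoint or intersect in a common face of both. A face of $\mathcal T(P)$ is a non-empty face (of any dimension from $0$ to $d$) of one of its tiles. A complete $k$-dimensional cone fan is a finite collection of convex polyhedral cones in a $k$-dimensional real affine space, with a common vertex (apex), which is closed under taking faces, in which any two cones intersect in a common face of both, and whose union is the whole space. Two such fans are (combinatorially) isomorphic, i.e. have the same combinatorial type, if there is an inclusion-preserving bijection, with inclusion-preserving inverse, between their sets of cones. For a $(d-k)$-dimensional face $F$ of $\mathcal T(P)$, let $\operatorname{lin}F$ be the linear subspace of $\mathbb R^d$ parallel to the affine hull of $F$, and let $\pi$ be the orthogonal projection along $\operatorname{lin}F$ onto the complementary $k$-dimensional space $(\operatorname{lin}F)^\perp$; then $\pi(F)$ is a point. The fan of $F$, denoted $\mathrm{Fan}(F)$, is the complete $k$-dimensional cone fan splitting $(\operatorname{lin}F)^\perp$ into convex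 polyhedral cones with vertex $\pi(F)$, for which there is a neighborhood $U$ of $\pi(F)$ such that every face $F'\supset F$ of $\mathcal T(P)$ (including $F$ itself and the tiles containing $F$) corresponds to a cone $C\in\mathrm{Fan}(F)$ with $\pi(F')\cap U=C\cap U$; the cones of $\mathrm{Fan}(F)$ are exactly the cones arising in this way. *)

(* Defs.v *)
From HB Require Import structures.
From mathcomp Require Import all_boot all_order all_algebra.
From mathcomp Require Import all_classical all_reals all_analysis.

Set Implicit Arguments.
Unset Strict Implicit.
Unset Printing Implicit Defensive.

Import Order.TTheory GRing.Theory Num.Theory.
Import numFieldNormedType.Exports.

Local Open Scope classical_set_scope.
Local Open Scope ring_scope.

Definition dotv (R : realType) (d : nat) (u v : 'rV[R]_d) : R :=
  \sum_i u 0 i * v 0 i.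

(* Linear subspaces of R^d are row spaces of square matrices.  [L] spans the
   subspace parallel to the affine hull of [F] when its row space is the
   smallest one containing all differences of points of [F]. *)
Definition is_direction (R : realType) (d : nat) (F : set 'rV[R]_d)
    (L : 'M[R]_d) : Prop :=
  forall V : 'M[R]_d,
    (L <= V)%MS <-> (forall x y, F x -> F y -> (x - y <= V)%MS).

(* Such an [L] always exists ([linP]), and its row space is unique. *)
Definition lin (R : realType) (d : nat) (F : set 'rV[R]_d) : 'M[R]_d :=
  xget 0 [set L | is_direction F L].

(* For nonempty [F] this is the dimension of its affine hull. *)
Definition adim (R : realType) (d : nat) (F : set 'rV[R]_d) : nat :=
  \rank (lin F).

Definition orthc (R : realType) (d : nat) (L : 'M[R]_d) : 'M[R]_d :=
  kermx L^T.

(* The orthogonal projection along [L] onto its orthogonal complement. *)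
Definition oproj (R : realType) (d : nat) (L : 'M[R]_d) (x : 'rV[R]_d) :
    'rV[R]_d :=
  x *m proj_mx (orthc L) L.

Definition polytope (R : realType) (d : nat) (P : set 'rV[R]_d) : Prop :=
  exists (n : nat) (v : 'I_n -> 'rV[R]_d),
    P = [set x | exists a : 'I_n -> R,
      [/\ forall i, 0 <= a i, \sum_i a i = 1 & x = \sum_i a i *: v i]].

(* Nonempty faces of a convex polyhedral set, cut out by valid linear
   inequalities; taking [c = 0] and [b = 0] shows that a nonempty [P] is a face
   of itself. *)
Definition is_face (R : realType) (d : nat) (P F : set 'rV[R]_d) : Prop :=
  F !=set0 /\
  exists (c : 'rV[R]_d) (b : R),
    (forall x, P x -> dotv c x <= b) /\ F = P `&` [set x | dotv c x = b].

Definition common_face (R : realType) (d : nat) (P Q F : set 'rV[R]_d) : Prop :=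
  is_face P F /\ is_face Q F.

Definition tile (R : realType) (d : nat) (P : set 'rV[R]_d) (t : 'rV[R]_d) :
    set 'rV[R]_d :=
  [set x + t | x in P].

(* [T] is the set of translation vectors. *)
Definition face_to_face_tiling (R : realType) (d : nat) (P T : set 'rV[R]_d) :
    Prop :=
  [/\ \bigcup_(t in T) tile P t = setT,
      forall t t', T t -> T t' -> t <> t' ->
        (tile P t)° `&` (tile P t')° = set0
    & forall t t', T t -> T t' -> t <> t' ->
        tile P t `&` tile P t' = set0 \/
        common_face (tile P t) (tile P t') (tile P t `&` tile P t')].

Definition parallelohedron (R : realType) (d : nat) (P : set 'rV[R]_d) : Prop :=
  [/\ polytope P, adim P = d & exists T, face_to_face_tiling P T].

Definition tiling_face (R : realType) (d : nat) (P T F : set 'rV[R]_d) : Prop :=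
  exists2 t, T t & is_face (tile P t) F.

(* A cone with vertex [a] is finitely generated from [a]; since [a] has to be a
   vertex, it contains no line. *)
Definition polyhedral_cone (R : realType) (d : nat) (a : 'rV[R]_d)
    (C : set 'rV[R]_d) : Prop :=
  is_face C [set a] /\
  exists (n : nat) (v : 'I_n -> 'rV[R]_d),
    C = [set x | exists c : 'I_n -> R,
      (forall i, 0 <= c i) /\ x = a + \sum_i c i *: v i].

Definition complete_cone_fan (R : realType) (k : nat)
    (S : set (set 'rV[R]_k)) : Prop :=
  finite_set S /\
  exists a : 'rV[R]_k,
    [/\ forall C, S C -> polyhedral_cone a C,
        forall C D, S C -> is_face C D -> S D,
        forall C D, S C -> S D -> common_face C D (C `&` D)
      & \bigcup_(C in S) C = setT].

Definition fan_isomorphic (R : realType) (m n : nat) (A : set (set 'rV[R]_m))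
    (B : set (set 'rV[R]_n)) : Prop :=
  exists f : set 'rV[R]_m -> set 'rV[R]_n,
    set_bij A B f /\
    forall C D, A C -> A D -> (C `<=` D <-> f C `<=` f D).

(* The cone [C] attached to a face [F'] containing [F] has the same germ at the
   vertex [p] as the projection of [F'], which determines it uniquely.  Only
   finitely many faces contain [F], so choosing the neighborhood [U] face by
   face is the same as choosing one for all of them. *)
Definition Fan (R : realType) (d : nat) (P T F : set 'rV[R]_d) :
    set (set 'rV[R]_d) :=
  [set C | exists p : 'rV[R]_d,
    [/\ oproj (lin F) @` F = [set p],
        polyhedral_cone p C,
        (forall x, C x -> (x <= orthc (lin F))%MS)
      & exists F', [/\ tiling_face P T F', F `<=` F' &
          exists2 U, nbhs p U & (oproj (lin F) @` F') `&` U = C `&` U]]].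

Lemma linP (R : realType) (d : nat) (F : set 'rV[R]_d) :
  is_direction F (lin F).
Proof.
pose G (V : 'M[R]_d) := forall x y, F x -> F y -> (x - y <= V)%MS.
have exG : exists n, `[< exists2 V, G V & \rank V = n >].
  by exists (\rank (1%:M : 'M[R]_d)); apply/asboolP; exists 1%:M => // x y _ _;
     exact: submx1.
have [n /asboolP [L GL rL] nmin] := ex_minnP exG.
suff dL : is_direction F L.
  by rewrite /lin; case: xgetP => [M -> //|/(_ L)].
move=> V; split=> [LV x y Fx Fy|GV]; first exact: submx_trans (GL _ _ Fx Fy) LV.
have GC : G (L :&: V)%MS by move=> x y Fx Fy; rewrite sub_capmx GL // GV.
have le_n : (n <= \rank (L :&: V)%MS)%N.
  by apply: nmin; apply/asboolP; exists (L :&: V)%MS.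
have /andP[_ LC] : (L :&: V == L)%MS.
  by rewrite -(geq_leqif (mxrank_leqif_eq (capmxSl L V))) rL.
exact: submx_trans LC (capmxSr _ _).
Qed.

Lemma oprojP (R : realType) (d : nat) (L : 'M[R]_d) (x : 'rV[R]_d) :
  (oproj L x <= orthc L)%MS /\ (x - oproj L x <= L)%MS.
Proof.
have cap0 : (orthc L :&: L = 0)%MS.
  apply/eqP; rewrite -submx0; apply/rV_subP => v.
  rewrite sub_capmx => /andP[/sub_kermxP vL /submxP[w vw]].
  have vv : v *m v^T = 0 by rewrite {2}vw trmx_mul mulmxA vL mul0mx.
  have /eqP : \sum_i v 0 i ^+ 2 = 0.
    have -> : \sum_i v 0 i ^+ 2 = (v *m v^T) 0 0.
      by rewrite mxE; apply: eq_bigr => i _; rewrite mxE.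
    by rewrite vv mxE.
  rewrite psumr_eq0 => [/allP v0|i _]; last exact: sqr_ge0.
  suff -> : v = 0 by exact: sub0mx.
  apply/rowP => i; rewrite mxE; apply/eqP.
  by have := v0 i (mem_index_enum _); rewrite /= sqrf_eq0.
have full : (x <= orthc L + L)%MS.
  apply: submx_full; rewrite /row_full.
  have := mxrank_sum_cap (orthc L) L.
  rewrite cap0 mxrank0 addn0 => ->.
  by rewrite /orthc mxrank_ker mxrank_tr subnK // rank_leq_row.
split; first exact: proj_mx_sub.
exact: proj_mx_compl_sub.
Qed.

(* Main.v *)
(* Two tiles containing [F] whose translation vectors almost agree modulo [lin F]
   overlap.  Measuring the difference against a basis of maximal determinant
   among the edge vectors of the polytope modulo [lin F], in which the polytope
   has coordinates in [-1, 1], the pigeonhole principle therefore bounds the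
   number of tiles containing [F] by a function of [k] alone.  Every face of the
   tiling is the intersection of the tiles containing it, so the number of faces
   containing [F], that is, of cones of [Fan F], is bounded as well.  The tangent
   cones at a relative interior point of [F], read in coordinates of the
   orthogonal complement of [lin F], form a complete fan of R^k isomorphic to
   [Fan F]; and there are finitely many inclusion patterns between boundedly
   many cones. *)

Require Import Defs.
From HB Require Import structures.
From mathcomp Require Import all_boot all_order all_algebra.
From mathcomp Require Import all_classical all_reals all_analysis.
From mathcomp Require Import ring lra.

Set Implicit Arguments.
Unset Strict Implicit.
Unset Printing Implicit Defensive.

Import Order.TTheory GRing.Theory Num.Theory.
Import numFieldNormedType.Exports.

Local Open Scope classical_set_scope.
Local Open Scope ring_scope.

(** * Bilinearity of the inner product *)

Lemma dotvE (R : realType) d (c u : 'rV[R]_d) : dotv c u = (u *m c^T) 0 0.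
Proof. by rewrite mxE; apply: eq_bigr => i _; rewrite mxE mulrC. Qed.

Lemma dotvDr (R : realType) d (c u v : 'rV[R]_d) :
  dotv c (u + v) = dotv c u + dotv c v.
Proof. by rewrite !dotvE mulmxDl mxE. Qed.

Lemma dotvZr (R : realType) d (c u : 'rV[R]_d) s : dotv c (s *: u) = s * dotv c u.
Proof. by rewrite !dotvE -scalemxAl mxE. Qed.

Lemma dotvBr (R : realType) d (c u v : 'rV[R]_d) :
  dotv c (u - v) = dotv c u - dotv c v.
Proof. by rewrite !dotvE mulmxBl !mxE. Qed.

Lemma dotv0r (R : realType) d (c : 'rV[R]_d) : dotv c 0 = 0.
Proof. by rewrite dotvE mul0mx mxE. Qed.

Lemma dotv0l (R : realType) d (u : 'rV[R]_d) : dotv 0 u = 0.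
Proof. by rewrite dotvE trmx0 mulmx0 mxE. Qed.

Lemma dotvDl (R : realType) d (b c u : 'rV[R]_d) :
  dotv (b + c) u = dotv b u + dotv c u.
Proof. by rewrite !dotvE linearD mulmxDr mxE. Qed.

Lemma dotvZl (R : realType) d (c u : 'rV[R]_d) s : dotv (s *: c) u = s * dotv c u.
Proof. by rewrite !dotvE linearZ -scalemxAr mxE. Qed.

Lemma dotv_sumr (R : realType) d n (c : 'rV[R]_d) (u : 'I_n -> 'rV[R]_d) :
  dotv c (\sum_i u i) = \sum_i dotv c (u i).
Proof.
by rewrite dotvE mulmx_suml summxE; apply: eq_bigr => i _; rewrite dotvE.
Qed.

Lemma dotv_mulmxr (R : realType) d k (c : 'rV[R]_d) (E : 'M[R]_(k, d)) z :
  dotv c (z *m E) = dotv (c *m E^T) z.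
Proof. by rewrite !dotvE trmx_mul trmxK mulmxA. Qed.

(** * Polytopes as convex hulls *)

(** One constant serves all columns. The added 1 keeps it positive even for [V = 0], so that radii
    can be divided by it. *)
Lemma mulmx_bound (R : realType) n d (V : 'M[R]_(n, d)) :
  exists2 K : R, 0 < K & forall (u : 'rV[R]_n) r, (forall i, `|u 0 i| <= r) ->
    0 <= r -> forall j, `|(u *m V) 0 j| <= K * r.
Proof.
exists (1 + \sum_j \sum_i `|V i j|).
  apply: ltr_pwDl => //; apply: sumr_ge0 => j _; exact: sumr_ge0.
move=> u r ur r0 j; rewrite mxE mulrDl mul1r.
apply: le_trans (ler_norm_sum _ _ _) _.
rewrite ler_wpDl // (bigD1 j) //= mulrDl ler_wpDr //.
  by rewrite mulr_ge0 // sumr_ge0 // => i _; exact: sumr_ge0.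
rewrite mulr_suml; apply: ler_sum => i _.
by rewrite normrM mulrC ler_wpM2l.
Qed.

Lemma nbhs_rVP (R : realType) d (x : 'rV[R]_d) (A : set 'rV[R]_d) :
  nbhs x A <-> exists2 r : R, 0 < r &
    forall u : 'rV[R]_d, (forall j, `|u 0 j| < r) -> A (x + u).
Proof.
split=> [/nbhs_ballP[r r0 rA]|[r r0 rA]].
  exists r => // u ur; apply: rA; split=> // i j.
  by rewrite ord1 /ball /= mxE opprD addrA subrr sub0r normrN.
apply/nbhs_ballP; exists r => // y [_ xy].
have -> : y = x + (y - x) by rewrite addrC subrK.
apply: rA => j; rewrite !mxE -normrN opprB; exact: xy.
Qed.

Lemma mulmx_continuous (R : realType) n d (V : 'M[R]_(n, d)) :
  continuous (fun u : 'rV[R]_n => u *m V).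
Proof.
move=> x A /nbhs_rVP[r r0 rA]; have [K K0 KV] := mulmx_bound V.
apply/nbhs_rVP; exists (r / (2 * K)); first by rewrite divr_gt0 ?mulr_gt0.
move=> u ur; rewrite /= mulmxDl; apply: rA => j.
have rK : 0 <= r / (2 * K) by rewrite divr_ge0 ?mulr_ge0 // ltW.
apply: le_lt_trans (KV u _ (fun i => ltW (ur i)) rK j) _.
have -> : K * (r / (2 * K)) = r / 2 by field; rewrite lt0r_neq0.
by rewrite ltr_pdivrMr // ltr_pMr // ltr1n.
Qed.

Lemma interior_affine (R : realType) d (A B : set 'rV[R]_d) (s : R) (b z : 'rV[R]_d) :
  0 < s -> (forall x, A x -> B (s *: x + b)) -> A° z -> B° (s *: z + b).
Proof.
move=> s0 AB /nbhs_rVP[r r0 rA]; apply/nbhs_rVP; exists (s * r).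
  exact: mulr_gt0.
move=> u us; have -> : s *: z + b + u = s *: (z + s^-1 *: u) + b.
  by rewrite scalerDr scalerA divff ?lt0r_neq0 // scale1r addrAC.
apply/AB/rA => j; rewrite mxE normrM gtr0_norm ?invr_gt0 //.
by rewrite mulrC ltr_pdivrMr // mulrC.
Qed.

(** Weights form a row vector and generators the rows of a matrix, so that convex combinations are
    products [a *m V] and matrix algebra applies to them. *)
Definition hull (R : realType) n d (V : 'M[R]_(n, d)) : set 'rV[R]_d :=
  [set x | exists a : 'rV[R]_n,
    [/\ forall i, 0 <= a 0 i, \sum_i a 0 i = 1 & x = a *m V]].

Lemma mulmx_rows (R : realType) n d (a : 'rV[R]_n) (V : 'M[R]_(n, d)) :
  a *m V = \sum_i a 0 i *: row i V.
Proof.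
by rewrite mulmx_sum_row.
Qed.

Lemma polytopeP (R : realType) d (P : set 'rV[R]_d) :
  polytope P <-> exists n (V : 'M[R]_(n, d)), P = hull V.
Proof.
split=> [[n [v ->]]|[n [V ->]]].
  exists n, (\matrix_i v i); apply/seteqP; split=> x [a [a0 a1 ->]].
    exists (\row_i a i); split=> [i||]; rewrite ?mxE //.
      by rewrite -a1; apply: eq_bigr => i _; rewrite mxE.
    by rewrite mulmx_rows; apply: eq_bigr => i _; rewrite mxE rowK.
  exists (a 0); split=> //; rewrite mulmx_rows.
  by apply: eq_bigr => i _; rewrite rowK.
exists n, (fun i => row i V); apply/seteqP; split=> x [a [a0 a1 ->]].
  by exists (a 0); split=> //; rewrite mulmx_rows.
exists (\row_i a i); split=> [i||]; rewrite ?mxE //.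
  by rewrite -a1; apply: eq_bigr => i _; rewrite mxE.
by rewrite mulmx_rows; apply: eq_bigr => i _; rewrite mxE.
Qed.

Lemma hull_row (R : realType) n d (V : 'M[R]_(n, d)) i : hull V (row i V).
Proof.
exists (delta_mx 0 i); split=> [j||]; last by rewrite rowE.
  by rewrite mxE /=; case: eqP.
rewrite (bigD1 i) //= big1 ?mxE ?eqxx ?addr0 // => j /negbTE ji.
by rewrite mxE ji.
Qed.

Lemma hull_sum (R : realType) n d (V : 'M[R]_(n, d)) (I : finType)
    (c : I -> R) (x : I -> 'rV[R]_d) :
  (forall i, 0 <= c i) -> \sum_i c i = 1 -> (forall i, hull V (x i)) ->
  hull V (\sum_i c i *: x i).
Proof.
move=> c0 c1 /choice[a ax]; exists (\sum_i c i *: a i); split=> [j||].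
- rewrite summxE sumr_ge0 // => i _; rewrite mxE mulr_ge0 //.
  by have [] := ax i.
- under eq_bigr do rewrite summxE.
  rewrite exchange_big -c1; apply: eq_bigr => i _ /=.
  under eq_bigr do rewrite mxE.
  by rewrite -mulr_sumr; have [_ -> _] := ax i; rewrite mulr1.
- rewrite mulmx_suml; apply: eq_bigr => i _; rewrite -scalemxAl.
  by have [_ _ ->] := ax i.
Qed.

Lemma polytope_sum (R : realType) d (P : set 'rV[R]_d) (I : finType)
    (c : I -> R) (x : I -> 'rV[R]_d) : polytope P ->
  (forall i, 0 <= c i) -> \sum_i c i = 1 -> (forall i, P (x i)) ->
  P (\sum_i c i *: x i).
Proof. by move=> /polytopeP[n [V ->]]; exact: hull_sum. Qed.

Lemma polytope_sum_sub (R : realType) d (P : set 'rV[R]_d) (I : finType)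
    (c : I -> R) (x : I -> 'rV[R]_d) z : polytope P ->
  (forall i, 0 <= c i) -> \sum_i c i <= 1 -> (forall i, P (x i)) -> P z ->
  P (\sum_i c i *: x i + (1 - \sum_i c i) *: z).
Proof.
move=> pP c0 c1 Px Pz.
(* The index [None] carries the missing weight, which is placed on [z]. *)
pose c' o := if o is Some i then c i else 1 - \sum_i c i.
pose x' o := if o is Some i then x i else z.
have sumo (V : zmodType) (f : option I -> V) :
    \sum_o f o = \sum_i f (Some i) + f None.
  rewrite (bigD1 None) //= addrC; congr (_ + _).
  rewrite (reindex_omap Some id) /=; last by case.
  by apply: eq_bigl => i; rewrite eqxx.
have -> : \sum_i c i *: x i + (1 - \sum_i c i) *: z = \sum_o c' o *: x' o.
  by rewrite sumo.
apply: polytope_sum => // [[i|]||[i|]] //=; first by rewrite subr_ge0.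
by rewrite sumo /= addrC subrK.
Qed.

Lemma polytope_conv (R : realType) d (P : set 'rV[R]_d) x y s : polytope P ->
  P x -> P y -> 0 <= s <= 1 -> P (x + s *: (y - x)).
Proof.
move=> pP Px Py /andP[s0 s1].
have := @polytope_sum_sub R d P unit (fun=> s) (fun=> y) x pP.
rewrite !big_const !card_unit /= !addr0 => /(_ (fun=> s0) s1 (fun=> Py) Px).
by rewrite scalerBr scalerBl scale1r [_ + (x - _)]addrCA.
Qed.

Lemma hull_bounded (R : realType) n d (V : 'M[R]_(n, d)) :
  exists2 B : R, 0 < B & forall x, hull V x -> forall j, `|x 0 j| <= B.
Proof.
have [K K0 KV] := mulmx_bound V; exists K => // _ [a [a0 a1 ->]] j.
rewrite -[K]mulr1; apply: KV => // i.
by rewrite ger0_norm // -a1 (bigD1 i) //= lerDl sumr_ge0.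
Qed.

(** The hull is the image of the standard simplex under a continuous map, and the simplex is compact
    because it is closed and bounded. *)
Lemma hull_closed (R : realType) n d (V : 'M[R]_(n, d)) : closed (hull V).
Proof.
suff cV : compact (hull V) by apply: compact_closed cV; exact: norm_hausdorff.
pose S := [set a : 'rV[R]_n | (forall i, 0 <= a 0 i) /\ \sum_i a 0 i = 1].
have -> : hull V = (fun a => a *m V) @` S.
  by apply/seteqP; split=> [x [a [? ? ->]]|x [a [? ?] <-]]; exists a.
apply: continuous_compact; first exact/continuous_subspaceT/mulmx_continuous.
apply: bounded_closed_compact.
  exists 1; split=> // M M1 a [a0 a1] /=.
  rewrite [X in X <= _](_ : _ = mx_norm a) // mx_normrE.
  apply: bigmax_le => [|[i j] _] /=.
    by rewrite ltW // (lt_trans ltr01).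
  rewrite ord1 ger0_norm // (le_trans _ (ltW M1)) //.
  by rewrite -a1 (bigD1 j) //= lerDl sumr_ge0.
have -> : S = (\bigcap_(i in [set: 'I_n])
    ((fun a : 'rV[R]_n => a 0 i) @^-1` [set t | 0 <= t])) `&`
    ((fun a : 'rV[R]_n => (a *m const_mx 1 : 'rV[R]_1) 0 0) @^-1` [set 1]).
  have sumE (a : 'rV[R]_n) : (a *m const_mx 1 : 'rV[R]_1) 0 0 = \sum_i a 0 i.
    by rewrite mxE; apply: eq_bigr => i _; rewrite mxE mulr1.
  apply/seteqP; split=> [a [a0 a1]|a [a0 a1]].
    by split=> [i _|]; [exact: a0|rewrite /= sumE].
  by split=> [i|]; [exact: a0|rewrite -sumE].
apply: closedI.
  apply: closed_bigI => i _; apply: closed_comp; last exact: closed_ge.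
  by move=> a _; exact: coord_continuous.
apply: closed_comp; last exact: closed_eq.
move=> a _; apply: (@continuous_comp _ _ _ (fun a : 'rV[R]_n => a *m const_mx 1)
   (fun b : 'rV[R]_1 => b 0 0)); first exact: mulmx_continuous.
exact: coord_continuous.
Qed.

Lemma sub_lin (R : realType) d (F : set 'rV[R]_d) x y :
  F x -> F y -> (x - y <= lin F)%MS.
Proof. by move=> Fx Fy; exact: (linP F (lin F)).1. Qed.

Definition centroid (R : realType) n d (V : 'M[R]_(n, d)) : 'rV[R]_d :=
  n%:R^-1 *: \sum_i row i V.

Definition centered (R : realType) n d (V : 'M[R]_(n, d)) (c : 'rV[R]_d) :
    'M[R]_(n, d) :=
  \matrix_i (row i V - c).

Lemma mul_centered (R : realType) n d (V : 'M[R]_(n, d)) c (b : 'rV[R]_n) :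
  b *m centered V c = b *m V - (\sum_i b 0 i) *: c.
Proof.
rewrite !mulmx_rows scaler_suml -sumrB; apply: eq_bigr => i _.
by rewrite rowK scalerBr.
Qed.

(** At the centroid all weights equal [n.+1%:R^-1], which leaves room for a small perturbation of
    each of them. *)
Lemma hull_near_centroid (R : realType) n d (V : 'M[R]_(n.+1, d))
    (b : 'rV[R]_n.+1) :
  (forall i, `|b 0 i| <= (2 * n.+1%:R)^-1) ->
  hull V (centroid V + b *m centered V (centroid V)).
Proof.
move=> bn; have n0 : n.+1%:R != 0 :> R by rewrite pnatr_eq0.
set s := \sum_i b 0 i.
have s2 : s <= 2^-1.
  have : s <= \sum_(i < n.+1) (2 * n.+1%:R)^-1.
    by apply: ler_sum => i _; apply: le_trans (ler_norm _) (bn i).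
  rewrite sumr_const card_ord -[_ *+ _]mulr_natr => /le_trans; apply.
  by rewrite invfM mulfVK.
(* Subtracting [s / n.+1%:R] from every weight restores the total 1. As [s] is at most 1/2, the
   second term is at least half the centroid weight and absorbs [b 0 i]. *)
exists (\row_i (b 0 i + (1 - s) / n.+1%:R)); split=> [i||].
- have := bn i; rewrite mxE ler_norml invfM => /andP[+ _].
  have s1 : 2^-1 / n.+1%:R <= (1 - s) / n.+1%:R.
    by rewrite ler_pM2r ?invr_gt0 ?ltr0n //; lra.
  by move=> /lerD/(_ s1); rewrite addNr.
- under eq_bigr do rewrite mxE.
  by rewrite big_split /= sumr_const card_ord -[_ *+ _]mulr_natr mulfVK // addrC subrK.
- rewrite mul_centered [in RHS]mulmx_rows.
  under [in RHS]eq_bigr do rewrite mxE scalerDl.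
  rewrite big_split /= -mulmx_rows -scaler_sumr -scalerA -/(centroid V).
  by rewrite scalerBl scale1r addrCA.
Qed.

Lemma hull_dim (R : realType) n d (V : 'M[R]_(n, d)) x :
  hull V x -> exists m, n = m.+1.
Proof.
move=> [a [_ a1 _]]; case: n V a a1 => [|m] V a; last by exists m.
by rewrite big_ord0 => /esym/eqP; rewrite oner_eq0.
Qed.

(** A difference of two weight vectors has coefficient sum 0, so the base point [c] cancels and may
    be arbitrary. *)
Lemma lin_hull (R : realType) n d (V : 'M[R]_(n, d)) c :
  (lin (hull V) <= centered V c)%MS.
Proof.
(* [is_direction] speaks of square matrices only, hence the passage to the generated square
   matrix. *)
apply: submx_trans (_ : lin (hull V) <= <<centered V c>>)%MS _; last first.
  by rewrite genmxE.
apply/(linP (hull V)) => x y [a [_ a1 ->]] [b [_ b1 ->]]; rewrite genmxE.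
apply/submxP; exists (a - b); rewrite mul_centered.
suff -> : \sum_i (a - b) 0 i = 0 by rewrite scale0r subr0 mulmxBl.
by under eq_bigr do rewrite !mxE; rewrite sumrB a1 b1 subrr.
Qed.

(** The algebraic form of the relative interior, equivalent to the topological one for convex sets;
    the step [s] may depend on the direction. *)
Definition relint (R : realType) d (F : set 'rV[R]_d) (x : 'rV[R]_d) :=
  F x /\ forall u, (u <= lin F)%MS -> exists2 s, 0 < s & F (x + s *: u).

Lemma polytope_relint (R : realType) d (F : set 'rV[R]_d) :
  polytope F -> F !=set0 -> exists x, relint F x.
Proof.
move=> /polytopeP[n [V FV]] [x0]; rewrite FV => /hull_dim[m nm].
subst n; exists (centroid V); split.
  rewrite -[centroid V]addr0 -[X in _ + X](mul0mx _ (centered V (centroid V))).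
  by apply: hull_near_centroid => i; rewrite mxE normr0 invr_ge0 mulr_ge0.
move=> u /submx_trans/(_ (lin_hull V (centroid V)))/submxP[b ->].
pose M := \sum_i `|b 0 i|.
have M0 : 0 <= M by exact: sumr_ge0.
exists ((2 * m.+1%:R)^-1 / (1 + M)).
  by rewrite divr_gt0 ?invr_gt0 ?mulr_gt0 ?ltr0n // ltr_pwDl.
rewrite scalemxAl; apply: hull_near_centroid => i; rewrite mxE normrM.
rewrite ger0_norm; last by rewrite divr_ge0 ?invr_ge0 ?mulr_ge0 // addr_ge0.
rewrite -mulrA ler_piMr ?invr_ge0 ?mulr_ge0 //.
rewrite mulrC ler_pdivrMr ?ltr_pwDl // mul1r.
by rewrite (le_trans (_ : _ <= M)) // ?lerDr // /M (bigD1 i) //= lerDl sumr_ge0.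
Qed.

Lemma polytope_interior (R : realType) d (P : set 'rV[R]_d) :
  polytope P -> P !=set0 -> adim P = d -> P° !=set0.
Proof.
move=> /polytopeP[n [V PV]] [x0]; rewrite PV => /hull_dim[m nm] Pd.
subst n; exists (centroid V).
have : row_full (centered V (centroid V)).
  rewrite /row_full eqn_leq rank_leq_col /=.
  by rewrite -[X in (X <= _)%N]Pd mxrankS // lin_hull.
(* A left inverse [W] of the centered matrix turns a small displacement into small weights around
   the centroid. *)
move=> /row_fullP[W WV]; have [K K0 KW] := mulmx_bound W.
have m0 : 0 < 2 * m.+1%:R :> R by rewrite mulr_gt0 ?ltr0n.
apply/nbhs_rVP; exists ((2 * m.+1%:R)^-1 / K).
  by rewrite divr_gt0 ?invr_gt0.
move=> u ur; rewrite -[u]mulmx1 -WV mulmxA; apply: hull_near_centroid => i.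
have := KW u _ (fun i => ltW (ur i)); rewrite [K * _]mulrC divfK ?lt0r_neq0 //.
by apply; rewrite divr_ge0 ?invr_ge0 // ltW.
Qed.

(** * Faces *)

Lemma face_self (R : realType) d (P : set 'rV[R]_d) :
  P !=set0 -> is_face P P.
Proof.
move=> P0; split=> //; exists 0, 0; split=> [x _|]; first by rewrite dotv0l.
by apply/seteqP; split=> [x Px|x []//]; split=> //=; rewrite dotv0l.
Qed.

Lemma face_sub (R : realType) d (P F : set 'rV[R]_d) : is_face P F -> F `<=` P.
Proof. by move=> [_ [c [b [_ ->]]]] x []. Qed.

(** A functional that is maximal at [x] cannot be smaller at a point [y] of [F]: prolonging the
    segment from [y] slightly past [x] stays in [F] and would exceed the maximum. *)
Lemma face_relint (R : realType) d (A G F : set 'rV[R]_d) x :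
  is_face A G -> F `<=` A -> relint F x -> G x -> F `<=` G.
Proof.
move=> [_ [c [b [cb ->]]]] FA [Fx xF] [_ /= cx] y Fy; split; first exact: FA.
apply/eqP; rewrite eq_le cb /=; last exact: FA.
have [s s0 /FA/cb] := xF (x - y) (sub_lin Fx Fy).
by rewrite dotvDr dotvZr dotvBr cx gerDl pmulr_rle0 // subr_le0.
Qed.

Lemma face_restrict (R : realType) d (P Q F : set 'rV[R]_d) :
  is_face P F -> F `<=` Q -> Q `<=` P -> is_face Q F.
Proof.
move=> [F0 [c [b [cb FE]]]] FQ QP; split=> //; exists c, b; split.
  by move=> x /QP/cb.
rewrite FE; apply/seteqP; split=> x; last by case=> /QP.
by move=> xF; split; [apply: FQ; rewrite FE|case: xF].
Qed.

(** The sum of two functionals reaches the sum of their bounds exactly where each reaches its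
    own. *)
Lemma face_setI (R : realType) d (P F G : set 'rV[R]_d) :
  is_face P F -> is_face P G -> F `&` G !=set0 -> is_face P (F `&` G).
Proof.
move=> [_ [c [b [cb FE]]]] [_ [c' [b' [cb' GE]]]] FG0; split=> //.
exists (c + c'), (b + b'); split=> [x Px|].
  by rewrite dotvDl lerD ?cb ?cb'.
rewrite FE GE; apply/seteqP; split=> x /=.
  by move=> [[Px cx] [_ c'x]]; split=> //; rewrite dotvDl cx c'x.
move=> [Px]; rewrite dotvDl; have := cb _ Px; have := cb' _ Px => ? ? ?.
by split; split=> //; lra.
Qed.

Lemma dotv_hull (R : realType) n d (V : 'M[R]_(n, d)) (c : 'rV[R]_d) (a : 'rV[R]_n) :
  dotv c (a *m V) = \sum_i a 0 i * dotv c (row i V).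
Proof. by rewrite mulmx_rows dotv_sumr; apply: eq_bigr => i _; rewrite dotvZr. Qed.

(** The defects [b - dotv c (row i V)] are nonnegative and their weighted sum vanishes, so each
    positive weight has defect 0. *)
Lemma face_support (R : realType) n d (V : 'M[R]_(n, d)) (c : 'rV[R]_d) b
    (a : 'rV[R]_n) :
  (forall x, hull V x -> dotv c x <= b) -> (forall i, 0 <= a 0 i) ->
  \sum_i a 0 i = 1 -> dotv c (a *m V) = b ->
  forall i, a 0 i != 0 -> dotv c (row i V) = b.
Proof.
move=> cb a0 a1 ab i ai.
have : \sum_i a 0 i * (b - dotv c (row i V)) = 0.
  under eq_bigr do rewrite mulrBr.
  by rewrite sumrB -mulr_suml a1 mul1r -dotv_hull ab subrr.
move/eqP; rewrite psumr_eq0; last first.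
  by move=> j _; rewrite mulr_ge0 // subr_ge0 cb //; exact: hull_row.
move=> /allP/(_ i (mem_index_enum _)) /=; rewrite mulf_eq0 (negPf ai) /=.
by rewrite subr_eq0 => /eqP.
Qed.

Lemma face_polytope (R : realType) d (P F : set 'rV[R]_d) :
  polytope P -> is_face P F -> polytope F.
Proof.
move=> /polytopeP[n [V ->]] [[x Fx] [c [b [cb FE]]]].
have cF y : F y -> dotv c y = b by rewrite FE => -[].
have sup (a : 'rV[R]_n) : (forall i, 0 <= a 0 i) -> \sum_i a 0 i = 1 -> F (a *m V) ->
    forall i, a 0 i != 0 -> F (row i V).
  move=> a0 a1 /cF ab i ai; rewrite FE; split; first exact: hull_row.
  exact: (face_support cb a0 a1 ab).
have [i0 Fi0] : exists i0, F (row i0 V).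
  move: (Fx); rewrite {1}FE => -[[a [a0 a1 xE]] _].
  have [i ai] : exists i, a 0 i != 0.
    apply: contrapT => /forallNP a00.
    have /eqP := a1; rewrite big1 ?[0 == 1]eq_sym ?oner_eq0 // => i _.
    by have /negP := a00 i; rewrite negbK => /eqP.
  by exists i; apply: (sup a) => //; rewrite -xE.
(* Rows outside [F] are replaced by a fixed row inside it, which keeps the index type and leaves the
   weights unchanged. *)
apply/polytopeP; exists n, (\matrix_i if `[< F (row i V) >] then row i V else row i0 V).
set W := \matrix_i _.
have FW i : F (row i W) by rewrite rowK; case: asboolP.
apply/seteqP; split=> y.
  move=> Fy; move: (Fy); rewrite {1}FE => -[[a [a0 a1 yE]] _].
  exists a; split=> //; rewrite yE !mulmx_rows; apply: eq_bigr => i _.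
  rewrite rowK; case: asboolP => // nF.
  have [->|/(sup a)] := eqVneq (a 0 i) 0; first by rewrite !scale0r.
  by rewrite -yE => /(_ a0 a1 Fy)/nF.
move=> [a [a0 a1 ->]]; rewrite FE; split.
  rewrite mulmx_rows; apply: hull_sum => // i.
  by have := FW i; rewrite FE => -[].
rewrite /= dotv_hull; under eq_bigr do rewrite cF //.
by rewrite -mulr_suml a1 mul1r.
Qed.

Lemma face_trans (R : realType) d (P F G : set 'rV[R]_d) :
  polytope P -> is_face P F -> is_face F G -> is_face P G.
Proof.
move=> /polytopeP[n [V ->]] [F0 [c [b [cb FE]]]] [G0 [c' [b' [cb' GE]]]].
split=> //.
have ge0 i : 0 <= b - dotv c (row i V) by rewrite subr_ge0 cb //; exact: hull_row.
(* A large multiple of the functional exposing [F] dominates the values of the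
   one exposing [G] at the vertices outside [F]. *)
have [M M0 MV] : exists2 M, 0 <= M & forall i, dotv c (row i V) < b ->
    dotv c' (row i V) - b' < M * (b - dotv c (row i V)).
  pose f i := (`|dotv c' (row i V) - b'| + 1) / (b - dotv c (row i V)).
  have f0 i : 0 <= f i by apply: divr_ge0 => //; exact: addr_ge0.
  exists (\sum_i f i); first by apply: sumr_ge0 => i _; exact: f0.
  move=> i ci; rewrite -ltr_pdivrMr ?subr_gt0 //.
  apply: (@lt_le_trans _ _ (f i)).
    rewrite ltr_pM2r ?invr_gt0 ?subr_gt0 //.
    by rewrite (le_lt_trans (ler_norm _)) // ltrDl.
  by rewrite (bigD1 i) //= lerDl sumr_ge0.
have cF y : F y -> dotv c y = b by rewrite FE => -[].
have val (a : 'rV[R]_n) : \sum_i a 0 i = 1 ->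
    M * b + b' - dotv (M *: c + c') (a *m V) =
    \sum_i a 0 i * (M * (b - dotv c (row i V)) - (dotv c' (row i V) - b')).
  move=> a1; rewrite dotv_hull -[M * b + b']mul1r -a1 mulr_suml -sumrB.
  by apply: eq_bigr => i _; rewrite dotvDl dotvZl; ring.
have gap i : 0 <= M * (b - dotv c (row i V)) - (dotv c' (row i V) - b').
  have [cib|] := ltP (dotv c (row i V)) b; first by rewrite subr_ge0 ltW // MV.
  move=> bci; have E : dotv c (row i V) = b.
    by apply/eqP; rewrite eq_le bci andbT -subr_ge0.
  rewrite E subrr mulr0 sub0r oppr_ge0 subr_le0 cb' // FE; split=> //.
  exact: hull_row.
exists (M *: c + c'), (M * b + b'); split.
  move=> _ [a [a0 a1 ->]]; rewrite -subr_ge0 val // sumr_ge0 // => i _.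
  exact: mulr_ge0.
rewrite GE; apply/seteqP; split=> x.
  move=> [Fx /= c'x]; split; first by move: Fx; rewrite FE => -[].
  by rewrite /= dotvDl dotvZl c'x cF.
move=> [[a [a0 a1 xE]] /= cx]; have Fx : F x.
  rewrite FE; split; first by exists a.
  have /eqP : M * b + b' - dotv (M *: c + c') (a *m V) = 0.
    by rewrite -xE cx subrr.
  rewrite val // psumr_eq0 => [/allP a00|i _]; last exact: mulr_ge0.
  rewrite /= xE dotv_hull -[RHS]mul1r -a1 mulr_suml; apply: eq_bigr => i _.
  have := a00 i (mem_index_enum _); rewrite /= mulf_eq0 => /orP[/eqP->|].
    by rewrite !mul0r.
  move=> g0; congr (_ * _); apply/eqP; rewrite eq_le -subr_ge0 ge0 /=.
  rewrite leNgt; apply/negP => /MV; rewrite -subr_gt0 lt_def.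
  by rewrite g0.
split=> //=; move: cx; rewrite dotvDl dotvZl cF // => /addrI; exact.
Qed.

(** * Local finiteness of tilings *)

(** The index of the box of side [r] containing [x] in a grid on the cube of half-side [B]. Inside
    this cube the truncation stays below the stated size, so [inord] loses nothing. *)
Definition cell (R : realType) n (B r : R) (x : 'rV[R]_n) :
    {ffun 'I_n -> 'I_(Num.truncn ((B + B) / r)).+1} :=
  [ffun i => inord (Num.truncn ((x 0 i + B) / r))].

Lemma cell_close (R : realType) n (B r : R) (x y : 'rV[R]_n) :
  0 < r -> (forall i, `|x 0 i| <= B) -> (forall i, `|y 0 i| <= B) ->
  cell B r x = cell B r y -> forall i, `|x 0 i - y 0 i| < r.
Proof.
move=> r0 xB yB /ffunP xy i; move: {xy}(xy i); rewrite !ffunE.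
move=> /(congr1 (@nat_of_ord _)).
have bnd (z : R) : `|z| <= B -> 0 <= (z + B) / r /\
    (Num.truncn ((z + B) / r) <= Num.truncn ((B + B) / r))%N.
  rewrite ler_norml => /andP[Bz zB]; have z0 : 0 <= (z + B) / r.
    by rewrite divr_ge0 ?(ltW r0) // -[B]opprK subr_ge0.
  by split=> //; apply: le_truncn; rewrite ler_pM2r ?invr_gt0 // lerD2r.
have [x0 xt] := bnd _ (xB i); have [y0 yt] := bnd _ (yB i).
rewrite !inordK ?ltnS // => E.
have /andP[xl xu] := truncn_itv x0; have /andP[yl yu] := truncn_itv y0.
rewrite E -natr1 in xu; rewrite E in xl; rewrite -natr1 in yu.
have H1 : (x 0 i + B) / r - (y 0 i + B) / r < 1 by lra.
have H2 : -1 < (x 0 i + B) / r - (y 0 i + B) / r by lra.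
move: H1 H2; rewrite -mulrBl opprD addrACA subrr addr0 ltr_pdivrMr // mul1r.
by rewrite ltr_pdivlMr // mulN1r ltr_norml => -> ->.
Qed.

(** Otherwise every value disappears from some index on, which is absurd at the largest of these
    indices. *)
Lemma infinite_pigeonhole (I : finType) (f : nat -> I) :
  exists c, forall N, exists2 n, (N <= n)%N & f n = c.
Proof.
apply: contrapT => /forallNP nc.
have /choice[g gP] : forall c, exists N, forall n, (N <= n)%N -> f n <> c.
  move=> c; have /existsNP[N NP] := nc c; exists N => n Nn fn.
  by apply: NP; exists n.
apply: (gP (f (\max_c g c)) (\max_c g c)) => //.
exact: (leq_bigmax (f _)).
Qed.

Lemma tileE (R : realType) d (P : set 'rV[R]_d) t x : tile P t x <-> P (x - t).
Proof.
by split=> [[y Py <-]|Px]; [rewrite addrK|exists (x - t); rewrite ?subrK].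
Qed.

Lemma tile_polytope (R : realType) d (P : set 'rV[R]_d) t :
  polytope P -> polytope (tile P t).
Proof.
move=> /polytopeP[n [V ->]]; apply/polytopeP; exists n, (\matrix_i (row i V + t)).
have E (a : 'rV[R]_n) : \sum_i a 0 i = 1 ->
    a *m (\matrix_i (row i V + t)) = a *m V + t.
  move=> a1; rewrite !mulmx_rows -[in RHS](scale1r t) -a1 scaler_suml -big_split.
  by apply: eq_bigr => i _; rewrite rowK scalerDr.
apply/seteqP; split=> [_ [_ [a [a0 a1 ->]] <-]|_ [a [a0 a1 ->]]].
  by exists a; split=> //; rewrite E.
by exists (a *m V); [exists a|rewrite E].
Qed.

Section Tiling.
Variables (R : realType) (d : nat) (P T : set 'rV[R]_d).
Hypothesis pP : polytope P.
Hypothesis iP : P° !=set0.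
Hypothesis TP : face_to_face_tiling P T.

(** Every tile has an interior box of the same size around the translate of [z]; translation vectors
    closer than this size make the interiors overlap. *)
Lemma tiling_separated : exists2 r : R, 0 < r & forall t t', T t -> T t' ->
  (forall j, `|t 0 j - t' 0 j| < r) -> t = t'.
Proof.
have [z zP] := iP; have [_ disj _] := TP; have /nbhs_rVP[r r0 rP] := zP.
(* Half of the radius pays for the shift between the tiles, the other half for a neighborhood. *)
exists (r / 2) => [|t t' Tt Tt' tt']; first by rewrite divr_gt0.
apply: contrapT => ne; suff : ((tile P t)° `&` (tile P t')°) (z + t).
  by rewrite disj.
split; first by rewrite -[z]scale1r; apply: interior_affine zP => // x Px;
  rewrite scale1r; exists x.
apply/nbhs_rVP; exists (r / 2); first by rewrite divr_gt0.
move=> u ur; apply/tileE; rewrite -!addrA; apply: rP => j.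
rewrite !mxE addrCA; apply: le_lt_trans (ler_normD _ _) _.
by rewrite [ltRHS]splitr ltrD.
Qed.

(* The tiles meeting a segment issued from [x] are finitely many, so one of them
   contains points of the segment arbitrarily close to [x]. *)
Lemma local_cover x u : exists t, [/\ T t, tile P t x &
  exists2 e, 0 < e & tile P t (x + e *: u)].
Proof.
have [cov _ _] := TP; have [r r0 sep] := tiling_separated.
have /choice[t tP] : forall n : nat, exists t, T t /\
    P (x + n.+1%:R^-1 *: u - t).
  move=> n; have : [set: 'rV[R]_d] (x + n.+1%:R^-1 *: u) by [].
  by rewrite -cov => -[t Tt /tileE]; exists t.
have /polytopeP[m [V PV]] := pP; have [B B0 BP] := hull_bounded V.
pose B' := \sum_j `|x 0 j| + \sum_j `|u 0 j| + B.
have tB n j : `|t n 0 j| <= B'.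
  have [_] := tP n; rewrite PV => /BP/(_ j).
  set v := x + _ - _ => vB; have -> : t n = x + n.+1%:R^-1 *: u - v.
    by rewrite /v opprB [_ + (t n - _)]addrC subrK.
  move: (v) vB => w wB; rewrite !mxE (le_trans (ler_normB _ _)) // lerD //.
  rewrite (le_trans (ler_normD _ _)) // lerD //.
    by rewrite (bigD1 j) //= lerDl sumr_ge0.
  rewrite normrM ger0_norm ?invr_ge0 // (bigD1 j) //= ler_wpDr ?sumr_ge0 //.
  by rewrite ler_piMl // invf_le1 ?ler1n ?ltr0n.
(* Translation vectors in one grid box coincide by separation, so a single tile contains infinitely
   many of the sampled points. *)
have [c cP] := infinite_pigeonhole (fun n => cell B' r (t n)).
have [n0 _ n0c] := cP 0.
have tE n : cell B' r (t n) = c -> t n = t n0.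
  move=> nc; apply: sep; [by have [] := tP n|by have [] := tP n0|].
  by apply: (@cell_close _ _ B' r) => //; exact: etrans nc (esym n0c).
exists (t n0); split; first by have [] := tP n0.
  (* Since [P] is closed, a point outside the tile has a whole box outside it, yet sampled points of
     that tile come arbitrarily close to [x]. *)
  apply/tileE; apply: contrapT => nP.
  have /nbhs_rVP[q q0 qP] : nbhs (x - t n0) (~` P).
    by apply: open_nbhs_nbhs; split=> //; apply: closed_openC; rewrite PV;
       exact: hull_closed.
  pose M := \sum_j `|u 0 j|; have M0 : 0 <= M by exact: sumr_ge0.
  have [n Nn nc] := cP (Num.truncn (M / q)).
  have [_] := tP n; rewrite tE // addrAC => nPn; apply: qP nPn => j.
  rewrite mxE normrM ger0_norm ?invr_ge0 // ltr_pdivrMl ?ltr0n //.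
  apply: (@le_lt_trans _ _ M); first by rewrite /M (bigD1 j) //= lerDl sumr_ge0.
  rewrite -ltr_pdivrMr //; apply: lt_le_trans (truncnS_gt _) _.
  by rewrite ler_nat ltnS.
exists n0.+1%:R^-1; first by rewrite invr_gt0 ltr0n.
by apply/tileE; have [] := tP n0.
Qed.

End Tiling.

(** * The number of tiles containing a face *)

(** A vector of the intersection is orthogonal to itself, so the sum of its squared entries is 0. *)
Lemma orthc_cap (R : realType) d (L : 'M[R]_d) : (orthc L :&: L = 0)%MS.
Proof.
apply/eqP; rewrite -submx0; apply/rV_subP => v.
rewrite sub_capmx => /andP[/sub_kermxP vL /submxP[w vw]].
have /eqP : \sum_i v 0 i ^+ 2 = 0.
  have -> : \sum_i v 0 i ^+ 2 = (v *m v^T) 0 0.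
    by rewrite mxE; apply: eq_bigr => i _; rewrite mxE.
  by rewrite {2}vw trmx_mul mulmxA vL mul0mx mxE.
rewrite psumr_eq0 => [/allP v0|i _]; last exact: sqr_ge0.
suff -> : v = 0 by exact: sub0mx.
apply/rowP => i; rewrite mxE; apply/eqP.
by have := v0 i (mem_index_enum _); rewrite /= sqrf_eq0.
Qed.

(* [E] parametrizes the orthogonal complement of [L], and [Q] reads off the
   corresponding coordinates. *)
Definition orth_coords (R : realType) d k (L : 'M[R]_d) (E : 'M[R]_(k, d))
    (Q : 'M[R]_(d, k)) :=
  [/\ E *m Q = 1%:M, L *m Q = 0, (E :=: orthc L)%MS &
      forall x, oproj L x = x *m Q *m E].

Lemma orth_coords_exists (R : realType) d k (L : 'M[R]_d) :
  (\rank L + k)%N = d -> exists E Q, @orth_coords R d k L E Q.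
Proof.
move=> Lk; have rk : \rank (orthc L) = k.
  by rewrite /orthc mxrank_ker mxrank_tr -[X in (X - _)%N]Lk addKn.
(* Replacing [k] by the rank gives [row_base] the required type. *)
case: k / rk {Lk}; set E := row_base (orthc L).
have EL : (E <= orthc L)%MS by rewrite eq_row_base.
have Efree : row_free E by exact: row_base_free.
exists E, (proj_mx (orthc L) L *m pinvmx E); split=> [|||x].
- by rewrite mulmxA proj_mx_id ?orthc_cap // mulmxVp.
- by rewrite mulmxA proj_mx_0 ?orthc_cap // mul0mx.
- exact: eq_row_base.
- have xE : (oproj L x <= E)%MS by rewrite eq_row_base; have [] := oprojP L x.
  by rewrite -[LHS](mulmxKpV xE) /oproj !mulmxA.
Qed.

Section Coords.
Variables (R : realType) (d k : nat) (L : 'M[R]_d) (E : 'M[R]_(k, d)).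
Variable Q : 'M[R]_(d, k).
Hypothesis EQ : orth_coords L E Q.

Lemma coordsK (z : 'rV[R]_k) : z *m E *m Q = z.
Proof. by have [EQ1 _ _ _] := EQ; rewrite -mulmxA EQ1 mulmx1. Qed.

Lemma coords_lin (u : 'rV[R]_d) : (u <= L)%MS -> u *m Q = 0.
Proof.
by have [_ LQ _ _] := EQ; move=> /submxP[w ->]; rewrite -mulmxA LQ mulmx0.
Qed.

Lemma coords_orth (z : 'rV[R]_k) : (z *m E <= orthc L)%MS.
Proof. by have [_ _ <- _] := EQ; exact: submxMl. Qed.

Lemma coords_rest (u : 'rV[R]_d) : (u - u *m Q *m E <= L)%MS.
Proof. by have [_ _ _ <-] := EQ; have [] := oprojP L u. Qed.

Lemma coords_id (u : 'rV[R]_d) : (u <= orthc L)%MS -> u *m Q *m E = u.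
Proof.
by have [_ _ <- _] := EQ; move=> /submxP[w ->]; rewrite coordsK.
Qed.

Lemma coords_ker (u : 'rV[R]_d) : u *m Q = 0 -> (u <= L)%MS.
Proof. by move=> u0; rewrite -[u]subr0 -(mul0mx _ E) -u0 coords_rest. Qed.

End Coords.

(* By Cramer's rule, the coordinates in a basis of maximal determinant are ratios
   of determinants bounded by 1. *)
Lemma maxdet_basis (R : realType) n k (V : 'M[R]_(n, k)) : row_full V ->
  exists2 f : 'I_k -> 'I_n, rowsub f V \in unitmx &
    forall i l, `|(row i V *m invmx (rowsub f V)) 0 l| <= 1.
Proof.
move=> fV; pose D (f : {ffun 'I_k -> 'I_n}) := `|\det (rowsub f V)|.
have [f0 Df0] : exists f, 0 < D f.
  exists (fullrankfun fV); rewrite normr_gt0 -unitfE -unitmxE.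
  exact: fullrowsub_unit.
pose f := [arg max_(g > f0) D g]%O.
have fmax g : D g <= D f by rewrite /f; case: Order.TotalTheory.arg_maxP => // h _; exact.
have Df : 0 < D f by exact: lt_le_trans (fmax f0).
exists f => [|i l]; first by rewrite unitmxE unitfE -normr_gt0.
(* Putting row [i] in place of the [l]-th selected row leaves the cofactors along that row
   unchanged, so the determinant is multiplied by the [l]-th coordinate. *)
pose g := [ffun a => if a == l then i else f a].
have detg : \det (rowsub g V) =
    (row i V *m invmx (rowsub f V)) 0 l * \det (rowsub f V).
  rewrite (expand_det_row _ l) mxE mulr_suml; apply: eq_bigr => j _.
  have -> : cofactor (rowsub g V) l j = cofactor (rowsub f V) l j.
    congr (_ * \det _); apply/matrixP => a b; rewrite !mxE ffunE.
    by rewrite eq_sym (negPf (neq_lift _ _)).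
  rewrite !mxE ffunE eqxx -mulrA; congr (_ * _).
  rewrite /invmx unitmxE unitfE -normr_gt0 Df !mxE mulrC mulVKf //.
  by rewrite -normr_gt0.
have := fmax g; rewrite /D detg normrM -ler_pdivlMr //.
by rewrite divff ?lt0r_neq0.
Qed.

(** The codomain of [cell] for the cube of half-side 1 and mesh [k.+1%:R^-1]. It does not depend on
    [d] or on the polytope, so one label set serves all tilings. *)
Definition tile_label (R : realType) (k : nat) : finType :=
  {ffun 'I_k -> 'I_(Num.truncn ((1 + 1) / k.+1%:R^-1 : R)).+1}.

Section Valence.
Variables (R : realType) (d k : nat) (P T F : set 'rV[R]_d).
Hypothesis pP : polytope P.
Hypothesis dP : adim P = d.
Hypothesis TP : face_to_face_tiling P T.
Hypothesis FT : tiling_face P T F.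
Hypothesis dF : (adim F + k)%N = d.

(* The component [l] of [t' - t] is absorbed by moving inside [F], and the other
   one by moving between the points [a i] and [b i] of the tiles; as the weights
   [c i] add up to less than 1, some weight is left for an interior point. *)
Lemma close_tiles_eq (x : 'rV[R]_d) m (c : 'I_m -> R) (a b : 'I_m -> 'rV[R]_d)
    (l t t' : 'rV[R]_d) :
  T t -> T t' -> F `<=` tile P t -> F `<=` tile P t' -> relint F x ->
  (forall i, 0 <= c i) -> \sum_i c i < 1 ->
  (forall i, P (a i)) -> (forall i, P (b i)) -> (l <= lin F)%MS ->
  t' - t = \sum_i c i *: a i - \sum_i c i *: b i + l -> t = t'.
Proof.
move=> Tt Tt' Ft Ft' [Fx xF] c0 c1 Pa Pb lF tt'.
have [s s0 Fs] := xF l lF; have [_ disj _] := TP.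
have P0 : P !=set0 by case: (FT) => u _ [[y Fy] _]; exists (x - t); apply/tileE/Ft.
have [z zP] := polytope_interior pP P0 dP.
(* This [th] solves [(1 - th) * s = th]: the move by [s *: l] inside [F], taken with weight
   [1 - th], then contributes exactly [th *: l]. *)
apply: contrapT => ne; pose th := s / (1 + s).
have s1 : 0 < 1 + s by rewrite addr_gt0.
have th0 : 0 < th by rewrite divr_gt0.
have th1 : 0 <= th <= 1 by rewrite ltW //= ler_pdivrMr // mul1r lerDr.
pose r := \sum_i c i; have r1 : 0 < 1 - r by rewrite subr_gt0.
(* A copy of [P] scaled by [th * (1 - r)] lies in the tile by convexity, and the image of the
   interior point [z] is interior. *)
have key (e : 'I_m -> 'rV[R]_d) y u : (forall i, P (e i)) -> tile P u y ->
    (tile P u)° ((th * (1 - r)) *: z +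
       (th *: (\sum_i c i *: e i + u) + (1 - th) *: y)).
  move=> Pe uy; apply: interior_affine zP; first exact: mulr_gt0.
  move=> w Pw; have := @polytope_conv _ _ _ y
    (\sum_i c i *: e i + (1 - r) *: w + u) th (tile_polytope u pP) uy.
  have -> : y + th *: (\sum_i c i *: e i + (1 - r) *: w + u - y) =
     (th * (1 - r)) *: w + (th *: (\sum_i c i *: e i + u) + (1 - th) *: y).
    move: (r) (\sum_i c i *: e i) => r' A.
    by apply/rowP => j; rewrite !mxE; ring.
  apply=> //; apply/tileE; rewrite addrK; apply: polytope_sum_sub => //.
  exact: ltW.
suff : ((tile P t)° `&` (tile P t')°) ((th * (1 - r)) *: z +
       (th *: (\sum_i c i *: b i + t') + (1 - th) *: x)) by rewrite disj.
split; last exact/key/Ft'.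
suff -> : th *: (\sum_i c i *: b i + t') + (1 - th) *: x =
    th *: (\sum_i c i *: a i + t) + (1 - th) *: (x + s *: l).
  exact/key/Ft.
have -> : t' = t + (t' - t) by rewrite addrC subrK.
have -> : (1 - th) *: (x + s *: l) = (1 - th) *: x + th *: l.
  rewrite scalerDr scalerA; congr (_ + _ *: _).
  by rewrite /th; field; rewrite lt0r_neq0.
rewrite tt'.
move: (\sum_i c i *: a i) (\sum_i c i *: b i) => A B.
by apply/rowP => j; rewrite !mxE; ring.
Qed.

Lemma valence : exists q : 'rV[R]_d -> tile_label R k,
  forall t t', T t -> T t' -> F `<=` tile P t -> F `<=` tile P t' ->
    q t = q t' -> t = t'.
Proof.
have [E [Q EQ]] := orth_coords_exists dF.
have [t0 Tt0 F0] := FT; have pF := face_polytope (tile_polytope t0 pP) F0.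
have [x rx] := polytope_relint pF F0.1; have [Fx _] := rx.
have /polytopeP[n [V PV]] := pP.
have [m nm] : exists m, n = m.+1.
  by apply: (@hull_dim _ _ _ V (x - t0)); rewrite -PV; apply/tileE/(face_sub F0).
subst n; pose c := row 0 V; pose D := centered V c.
have fD : row_full (D *m Q).
  have /row_fullP[W WD] : row_full D.
    rewrite /row_full eqn_leq rank_leq_col /= -[X in (X <= _)%N]dP mxrankS //.
    by rewrite PV lin_hull.
  apply/row_fullP; exists (E *m W); rewrite mulmxA -(mulmxA E) WD mulmx1.
  by case: EQ.
have [f fU f1] := maxdet_basis fD; set W := rowsub f _ in fU f1.
(* The coordinates of [x - t] from the vertex [c], modulo [lin F], in the selected edge basis. They
   lie in [-1, 1] because [x - t] is a convex combination of the rows of [V]. *)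
pose la t := (x - t - c) *m Q *m invmx W.
have la1 t : F `<=` tile P t -> forall l, `|la t 0 l| <= 1.
  move=> Ft l; have : hull V (x - t) by rewrite -PV; apply/tileE/Ft.
  move=> [a [a0 a1 xE]]; have -> : la t = a *m (D *m Q *m invmx W).
    by rewrite /la xE !mulmxA mul_centered a1 scale1r.
  rewrite mulmx_rows summxE (le_trans (ler_norm_sum _ _ _)) // -a1.
  apply: ler_sum => i _; rewrite mxE normrM (ger0_norm (a0 i)) row_mul.
  by rewrite ler_piMr.
exists (fun t => cell 1 k.+1%:R^-1 (la t)) => t t' Tt Tt' Ft Ft' lat.
have k0 : 0 < k.+1%:R^-1 :> R by rewrite invr_gt0 ltr0n.
pose mu := la t - la t'.
have mu1 l : `|mu 0 l| < k.+1%:R^-1.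
  by rewrite mxE [X in _ + X]mxE; apply: (cell_close k0 (la1 _ Ft) (la1 _ Ft') lat).
have muW : mu *m W = (t' - t) *m Q.
  rewrite /mu /la -mulmxBl mulmxKV // -mulmxBl; congr (_ *m _).
  by apply/rowP => j; rewrite !mxE; ring.
pose l := t' - t - mu *m rowsub f D.
have lF : (l <= lin F)%MS.
  apply: (coords_ker EQ); rewrite /l mulmxBl -muW -mulmxA.
  suff -> : rowsub f D *m Q = W by rewrite subrr.
  by rewrite /W mul_rowsub_mx.
(* The sign of [mu 0 i] decides which tile uses the far end of the edge, so that the weights can be
   the nonnegative numbers [|mu 0 i|]. *)
pose a i := if 0 <= mu 0 i then row (f i) V else c.
pose b i := if 0 <= mu 0 i then c else row (f i) V.
apply: (@close_tiles_eq x k (fun i => `|mu 0 i|) a b l) => //.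
(* The chosen mesh bounds the sum of the [k] weights by [k / (k + 1)], which is below 1 even for
   [k = 0]. *)
- apply: (@le_lt_trans _ _ (\sum_(i < k) k.+1%:R^-1)).
    by apply: ler_sum => i _; exact/ltW/mu1.
  rewrite sumr_const card_ord -[_ *+ _]mulr_natr mulrC.
  by rewrite ltr_pdivrMr ?ltr0n // mul1r ltr_nat.
- by move=> i; rewrite /a PV; case: ifP => _; exact: hull_row.
- by move=> i; rewrite /b PV; case: ifP => _; exact: hull_row.
- rewrite -sumrB; suff -> : \sum_i (`|mu 0 i| *: a i - `|mu 0 i| *: b i) =
    mu *m rowsub f D by rewrite [RHS]addrC subrK.
  rewrite mulmx_rows; apply: eq_bigr => i _; rewrite -scalerBr.
  have -> : row i (rowsub f D) = row (f i) V - c.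
    by apply/rowP => j; rewrite !mxE.
  rewrite /a /b; case: ifP => mui; first by rewrite ger0_norm.
  by rewrite ltr0_norm ?ltNge ?mui // scaleNr -scalerN opprB.
Qed.

End Valence.

(** * The faces containing [F] and their tangent cones *)

Section TilingFaces.
Variables (R : realType) (d : nat) (P T : set 'rV[R]_d).
Hypothesis pP : polytope P.
Hypothesis dP : adim P = d.
Hypothesis TP : face_to_face_tiling P T.

Lemma tiling_face_polytope F : tiling_face P T F -> polytope F.
Proof. by move=> [t _ Ft]; exact: face_polytope (tile_polytope t pP) Ft. Qed.

(** The set [F] lies in the common face of the two tiles and is a face of it; transitivity then
    applies on the side of [t]. *)
Lemma tile_face F t : tiling_face P T F -> T t -> F `<=` tile P t ->
  is_face (tile P t) F.
Proof.
move=> [s Ts sF] Tt Ft; have [<-//|/eqP st] := eqVneq s t.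
have [_ _ /(_ s t Ts Tt st)[st0|[sG tG]]] := TP.
  have [y Fy] := sF.1; suff : set0 y by [].
  by rewrite -st0; split; [exact: (face_sub sF)|exact: Ft].
apply: face_trans tG _; first exact: tile_polytope.
apply: (face_restrict sF) => [y Fy|y []//].
by split; [exact: (face_sub sF)|exact: Ft].
Qed.

Lemma tile_relint F t x : tiling_face P T F -> T t -> relint F x -> tile P t x ->
  F `<=` tile P t.
Proof.
move=> [s Ts sF] Tt rx tx; have [<-//|/eqP st] := eqVneq s t.
  exact: face_sub sF.
have [Fx _] := rx; have sx := face_sub sF Fx.
have [_ _ /(_ s t Ts Tt st)[st0|[sG _]]] := TP.
  by suff : set0 x by []; rewrite -st0.
have := face_relint sG (face_sub sF) rx (conj sx tx).
by move=> FG y /FG[].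
Qed.

(** Cutting [F2] down to the tile of [F1] gives a face of that tile, and two faces of the same tile
    meet in a face. *)
Lemma tiling_faceI F1 F2 : tiling_face P T F1 -> tiling_face P T F2 ->
  F1 `&` F2 !=set0 -> is_face F1 (F1 `&` F2) /\ tiling_face P T (F1 `&` F2).
Proof.
move=> [t1 T1 t1F] [t2 T2 t2F] F0.
have F21 : tiling_face P T (F2 `&` tile P t1).
  exists t2 => //; have [->|/eqP t12] := eqVneq t1 t2.
    suff -> : F2 `&` tile P t2 = F2 by [].
    by apply/seteqP; split=> [y []//|y Fy]; split=> //; exact: (face_sub t2F).
  have [y [F1y F2y]] := F0.
  have [_ _ /(_ t1 t2 T1 T2 t12)[t0|[_ t2G]]] := TP.
    suff : set0 y by []; rewrite -t0.
    by split; [exact: (face_sub t1F)|exact: (face_sub t2F)].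
  have -> : F2 `&` tile P t1 = F2 `&` (tile P t1 `&` tile P t2).
    apply/seteqP; split=> [v [F2v tv]|v [F2v [tv _]]]; split=> //.
    by split=> //; exact: (face_sub t2F).
  apply: face_setI => //; exists y; split=> //.
  by split; [exact: (face_sub t1F)|exact: (face_sub t2F)].
have E : F1 `&` F2 = F1 `&` (F2 `&` tile P t1).
  apply/seteqP; split=> [v [F1v F2v]|v [F1v [F2v _]]]; split=> //.
  by split=> //; exact: (face_sub t1F).
have tF : is_face (tile P t1) (F1 `&` F2).
  rewrite E; apply: face_setI => //; last by rewrite -E.
  by apply: tile_face F21 T1 _ => y [].
split; last by exists t1.
by apply: face_restrict tF _ (face_sub t1F) => y [].
Qed.

Lemma polytope_nonempty_interior F : tiling_face P T F -> P° !=set0.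
Proof.
move=> [t Tt tF]; apply: polytope_interior => //.
by have [[y /(face_sub tF)/tileE Py] _] := tF; exists (y - t).
Qed.

(* Prolonging the segment from [y] through a relative interior point of [F] leads
   into a tile which contains [F], hence [y]; its intersection with a given tile
   through [F] is a face of it, so the prolonged segment stays in that tile,
   which a functional exposing [F] forbids unless [y] lies in [F]. *)
Lemma tiling_face_bigcap F y : tiling_face P T F ->
  (forall t, T t -> F `<=` tile P t -> tile P t y) -> F y.
Proof.
move=> TF all_y; have iP := polytope_nonempty_interior TF.
have [s Ts sF] := TF; have sy := all_y s Ts (face_sub sF).
have [x rx] := polytope_relint (tiling_face_polytope TF) sF.1.
have [Fx _] := rx; have sx := face_sub sF Fx.
have [t [Tt tx [e e0 tz]]] := local_cover pP iP TP x (x - y).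
have ty := all_y t Tt (tile_relint TF Tt rx tx).
have sz : tile P s (x + e *: (x - y)).
  have [->//|/eqP st] := eqVneq s t.
  have [_ _ /(_ s t Ts Tt st)[st0|[_ tG]]] := TP.
    by suff : set0 x by []; rewrite -st0.
  suff : (tile P s `&` tile P t) (x + e *: (x - y)) by case.
  case: tG => _ [c [b [cb GE]]].
  have cx : dotv c x = b by have : (tile P s `&` tile P t) x by []; rewrite GE => -[].
  have cy : dotv c y = b by have : (tile P s `&` tile P t) y by []; rewrite GE => -[].
  by rewrite GE; split=> //=; rewrite dotvDr dotvZr dotvBr cx cy subrr mulr0 addr0.
have [_ [c [b [cb FE]]]] := sF; rewrite FE; split=> //=.
have cx : dotv c x = b by move: Fx; rewrite FE => -[].
apply/eqP; rewrite eq_le cb //=; have := cb _ sz.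
by rewrite dotvDr dotvZr dotvBr cx gerDl pmulr_rle0 // subr_le0.
Qed.

End TilingFaces.

Section Star.
Variables (R : realType) (d k : nat) (P T F : set 'rV[R]_d).
Hypothesis pP : polytope P.
Hypothesis dP : adim P = d.
Hypothesis TP : face_to_face_tiling P T.
Hypothesis FT : tiling_face P T F.
Hypothesis dF : (adim F + k)%N = d.

Definition star (F' : set 'rV[R]_d) := tiling_face P T F' /\ F `<=` F'.

Variables (E : 'M[R]_(k, d)) (Q : 'M[R]_(d, k)) (x0 : 'rV[R]_d).
Hypothesis EQ : orth_coords (lin F) E Q.
Hypothesis rx0 : relint F x0.

Let Fx0 : F x0. Proof. by case: rx0. Qed.

Lemma star_polytope F' : star F' -> polytope F'.
Proof. by move=> [/(tiling_face_polytope pP)]. Qed.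

Lemma star_self : star F. Proof. by split. Qed.

Lemma star_tile t : T t -> F `<=` tile P t -> star (tile P t).
Proof.
by move=> Tt Ft; split=> //; exists t => //; apply: face_self; exists x0; exact: Ft.
Qed.

Lemma starI F1 F2 : star F1 -> star F2 ->
  is_face F1 (F1 `&` F2) /\ star (F1 `&` F2).
Proof.
move=> [T1 F1F] [T2 F2F].
have F12 : F `<=` F1 `&` F2 by move=> y Fy; split; [exact: F1F|exact: F2F].
by have [|? ?] := tiling_faceI pP TP T1 T2; first by exists x0; exact: F12.
Qed.

Lemma star_face F1 F2 : star F1 -> is_face F1 F2 -> F `<=` F2 -> star F2.
Proof.
move=> [[t Tt tF] _] F12 FF2; split=> //; exists t => //.
exact: face_trans (tile_polytope t pP) tF F12.
Qed.

Lemma star_base F' : star F' -> is_face F' F.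
Proof.
move=> [[t Tt tF] FF']; have tFF : F `<=` tile P t.
  by move=> y /FF'; exact: face_sub.
by apply: face_restrict (tile_face pP TP FT Tt tFF) FF' (face_sub tF).
Qed.

(* The cone of [F'] in the coordinates [E], with its vertex moved to the
   origin. *)
Definition tcone (F' : set 'rV[R]_d) : set 'rV[R]_k :=
  [set z | exists2 e, 0 < e & F' (x0 + e *: (z *m E))].

Lemma tcone_small F' z e e' : star F' -> F' (x0 + e *: (z *m E)) -> 0 <= e' <= e ->
  F' (x0 + e' *: (z *m E)).
Proof.
move=> sF' Fz /andP[e'0 e'e]; have F'x : F' x0 by exact: sF'.2.
have [e0|e0] := eqVneq e 0.
  have -> : e' = 0 by apply/eqP; rewrite eq_le e'0 andbT -e0.
  by rewrite scale0r addr0.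
have ep : 0 < e by rewrite lt_def e0 (le_trans e'0).
have := @polytope_conv _ _ _ _ _ (e' / e) (star_polytope sF') F'x Fz.
rewrite addrAC subrr add0r scalerA mulfVK //; apply.
by rewrite divr_ge0 ?(ltW ep) //= ler_pdivrMr // mul1r.
Qed.

Lemma tcone0 F' : star F' -> tcone F' 0.
Proof. by move=> sF'; exists 1 => //; rewrite mul0mx scaler0 addr0; exact: sF'.2. Qed.

Lemma tconeZ F' z s : star F' -> tcone F' z -> 0 <= s -> tcone F' (s *: z).
Proof.
move=> sF' [e e0 Fz]; rewrite le_eqVlt => /orP[/eqP<-|s0].
  by rewrite scale0r; exact: tcone0.
exists (e / s); first exact: divr_gt0.
by rewrite -scalemxAl scalerA divfK ?lt0r_neq0.
Qed.

Lemma tconeD F' z1 z2 : star F' -> tcone F' z1 -> tcone F' z2 ->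
  tcone F' (z1 + z2).
Proof.
move=> sF' [e1 e10 Fz1] [e2 e20 Fz2]; pose e := Num.min e1 e2.
have e0 : 0 < e by rewrite lt_min e10.
(* The midpoint of the points reached at the common scale [e] is the sum reached at half that
   scale. *)
exists (2^-1 * e); first by rewrite mulr_gt0 ?invr_gt0.
have {}Fz1 : F' (x0 + e *: (z1 *m E)).
  by apply: tcone_small Fz1 _ => //; rewrite ltW //= ge_min lexx.
have {}Fz2 : F' (x0 + e *: (z2 *m E)).
  by apply: tcone_small Fz2 _ => //; rewrite ltW //= ge_min lexx orbT.
have := @polytope_conv _ _ _ _ _ 2^-1 (star_polytope sF') Fz1 Fz2.
have -> : x0 + e *: (z1 *m E) + 2^-1 *: (x0 + e *: (z2 *m E) - (x0 + e *: (z1 *m E)))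
   = x0 + (2^-1 * e) *: ((z1 + z2) *m E).
  rewrite mulmxDl; move: (z1 *m E) (z2 *m E) => a b.
  by apply/rowP => j; rewrite !mxE; field.
by apply; rewrite invr_ge0 ler0n /= invf_le1 // ler1n.
Qed.

Lemma tcone_sum F' n (c : 'I_n -> R) (z : 'I_n -> 'rV[R]_k) : star F' ->
  (forall i, 0 <= c i) -> (forall i, tcone F' (z i)) ->
  tcone F' (\sum_i c i *: z i).
Proof.
move=> sF' c0 Fz; elim/big_rec: _ => [|i y _]; first exact: tcone0.
by apply: tconeD => //; exact: tconeZ.
Qed.

(** The component [l] of [u - x0] along [lin F] is cancelled by averaging [u] with the point of [F]
    displaced by [- l]; the weight [s / (1 + s)] makes both contributions equal. *)
Lemma tcone_proj F' u : star F' -> F' u -> tcone F' ((u - x0) *m Q).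
Proof.
move=> sF' F'u; pose l := u - x0 - (u - x0) *m Q *m E.
have lF : (- l <= lin F)%MS by rewrite eqmx_opp; exact: (coords_rest EQ).
have [s s0 Fs] := rx0.2 _ lF.
have s1 : 0 < 1 + s by rewrite addr_gt0.
exists (s / (1 + s)); first exact: divr_gt0.
have := @polytope_conv _ _ _ _ _ (s / (1 + s)) (star_polytope sF') (sF'.2 _ Fs) F'u.
have -> : x0 + s *: - l + s / (1 + s) *: (u - (x0 + s *: - l)) =
   x0 + s / (1 + s) *: ((u - x0) *m Q *m E).
  rewrite /l; move: (_ *m E) => w.
  by apply/rowP => j; rewrite !mxE; field; rewrite lt0r_neq0.
apply; rewrite divr_ge0 ?(ltW s0) ?(ltW s1) //=.
by rewrite ler_pdivrMr // mul1r lerDr.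
Qed.

(** Relative to [x0], points of [F'] are convex combinations of the vectors [row i W - x0]; dividing
    by the scale [e] turns the weights into arbitrary nonnegative coefficients. *)
Lemma tcone_gen F' n (W : 'M[R]_(n, d)) : star F' -> F' = hull W ->
  tcone F' = [set z | exists c : 'I_n -> R, (forall i, 0 <= c i) /\
    z = \sum_i c i *: ((row i W - x0) *m Q)].
Proof.
move=> sF' FW; apply/seteqP; split=> z /=; last first.
  move=> [c [c0 ->]]; apply: tcone_sum => // i; apply: tcone_proj => //.
  by rewrite FW; exact: hull_row.
move=> [e e0]; rewrite FW => -[a [a0 a1 aE]].
exists (fun i => e^-1 * a 0 i); split=> [i|].
  by rewrite mulr_ge0 // invr_ge0 ltW.
rewrite -[z](coordsK EQ) -[z *m E](scalerK (lt0r_neq0 e0)).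
have -> : e *: (z *m E) = a *m W - x0 by rewrite -aE addrAC subrr add0r.
rewrite (mulmx_rows a W) -[X in _ - X]scale1r -a1 scaler_suml -sumrB.
rewrite scaler_sumr mulmx_suml; apply: eq_bigr => i _.
by rewrite -scalerBr scalerA scalemxAl.
Qed.

(** The functional exposing [F2] reaches its bound at [x0], so measured from [x0] it becomes
    homogeneous. *)
Lemma tcone_face F1 F2 : star F1 -> F `<=` F2 -> is_face F1 F2 ->
  exists c, (forall z, tcone F1 z -> dotv c (z *m E) <= 0) /\
    tcone F2 = tcone F1 `&` [set z | dotv c (z *m E) = 0].
Proof.
move=> sF1 FF2 [_ [c [b [cb F2E]]]]; exists c.
have cx0 : dotv c x0 = b by have := FF2 _ Fx0; rewrite F2E => -[].
split=> [z [e e0 /cb]|].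
  by rewrite dotvDr cx0 dotvZr gerDl pmulr_rle0.
rewrite F2E; apply/seteqP; split=> z /=.
  move=> [e e0 [F1z /= cz]]; split; first by exists e.
  move/eqP: cz; rewrite dotvDr cx0 dotvZr -subr_eq0 addrAC subrr add0r.
  by rewrite mulf_eq0 gt_eqF //= => /eqP.
move=> [[e e0 F1z] /= cz]; exists e => //; split=> //=.
by rewrite dotvDr cx0 dotvZr cz mulr0 addr0.
Qed.

Lemma tcone_base : tcone F = [set 0].
Proof.
apply/seteqP; split=> z /=; last by move=> ->; exact: (tcone0 star_self).
move=> [e e0 Fz]; have /(coords_lin EQ) := sub_lin Fz Fx0.
rewrite addrAC subrr add0r -scalemxAl (coordsK EQ) => /eqP.
by rewrite scaler_eq0 gt_eqF //= => /eqP.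
Qed.

Lemma tcone_is_face F1 F2 : star F1 -> F `<=` F2 -> is_face F1 F2 ->
  is_face (tcone F1) (tcone F2).
Proof.
move=> s1 FF2 F12; have [c [c0 ->]] := tcone_face s1 FF2 F12.
split; first by exists 0; split; [exact: tcone0|rewrite /= mul0mx dotv0r].
exists (c *m E^T), 0; split=> [z /c0|]; first by rewrite dotv_mulmxr.
by apply/seteqP; split=> z /= [Cz]; rewrite dotv_mulmxr.
Qed.

Lemma tcone_polyhedral F' : star F' -> polyhedral_cone 0 (tcone F').
Proof.
move=> sF'; split.
  by rewrite -tcone_base; apply: tcone_is_face => //; exact: star_base.
have /polytopeP[n [W FW]] := star_polytope sF'.
exists n, (fun i => (row i W - x0) *m Q); rewrite (tcone_gen sF' FW).
by apply/seteqP; split=> z [c [c0 zE]]; exists c; move: zE; rewrite add0r.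
Qed.

(** A functional exposing a face of the cone has bound 0; pulled back through [Q] it is constant on
    [F] and exposes a face of [F'] containing [F]. *)
Lemma face_tcone F' D : star F' -> is_face (tcone F') D ->
  exists2 F2, star F2 & D = tcone F2.
Proof.
move=> sF' [[z1 Dz1] [e [b [eb DE]]]].
have b0 : b = 0.
  have [Cz1 ez1] : tcone F' z1 /\ dotv e z1 = b by move: Dz1; rewrite DE.
  (* The apex gives [0 <= b], and doubling [z1] inside the cone gives [2 * b <= b]. *)
  apply/eqP; rewrite eq_le -{2}(dotv0r e) eb ?andbT; last exact: tcone0.
  have := eb _ (tconeZ sF' Cz1 (ler0n R 2)).
  by rewrite dotvZr ez1; lra.
subst b; pose c := e *m Q^T.
have cE u : dotv c u = dotv e (u *m Q) by rewrite dotv_mulmxr.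
have cEE z : dotv c (z *m E) = dotv e z by rewrite cE (coordsK EQ).
have cF u : F u -> dotv c u = dotv c x0.
  move=> Fu; apply/eqP; rewrite -subr_eq0 -dotvBr cE (coords_lin EQ) ?dotv0r //.
  exact: sub_lin.
pose F2 := F' `&` [set u | dotv c u = dotv c x0].
have FF2 : F `<=` F2 by move=> u Fu; split; [exact: sF'.2|exact: cF].
have F2f : is_face F' F2.
  split; first by exists x0; exact: FF2.
  exists c, (dotv c x0); split=> // u F'u; rewrite -subr_le0 -dotvBr cE.
  exact/eb/tcone_proj.
exists F2; first exact: star_face F2f FF2.
rewrite DE; apply/seteqP; split=> z /= [].
  move=> [r r0 F'z] ez; exists r => //; split=> //=.
  by rewrite dotvDr dotvZr cEE ez mulr0 addr0.
move=> r r0 [F'z /eqP]; rewrite dotvDr dotvZr cEE.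
rewrite -subr_eq0 addrAC subrr add0r mulf_eq0 gt_eqF //= => /eqP ez.
by split=> //; exists r.
Qed.

Lemma tconeI F1 F2 : star F1 -> star F2 ->
  tcone F1 `&` tcone F2 = tcone (F1 `&` F2).
Proof.
move=> s1 s2; apply/seteqP; split=> z /=; last first.
  by move=> [e e0 [F1z F2z]]; split; exists e.
move=> [[e1 e10 Fz1] [e2 e20 Fz2]]; exists (Num.min e1 e2).
  by rewrite lt_min e10.
split.
  by apply: tcone_small Fz1 _ => //; rewrite ge_min lexx andbT le_min !ltW.
by apply: tcone_small Fz2 _ => //; rewrite ge_min lexx orbT andbT le_min !ltW.
Qed.

Lemma tcone_cover z : exists2 F', star F' & tcone F' z.
Proof.
have iP := polytope_nonempty_interior pP dP FT.
have [t [Tt tx [e e0 tz]]] := local_cover pP iP TP x0 (z *m E).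
exists (tile P t); last by exists e.
by apply: star_tile => //; exact: tile_relint FT Tt rx0 tx.
Qed.

Lemma tcone_fan : finite_set (tcone @` star) -> complete_cone_fan (tcone @` star).
Proof.
move=> fS; split=> //; exists 0; split.
- by move=> _ [F1 s1 <-]; exact: tcone_polyhedral.
- by move=> _ D [F1 s1 <-] /(face_tcone s1)[F2 s2 ->]; exists F2.
- move=> _ _ [F1 s1 <-] [F2 s2 <-]; rewrite tconeI //.
  have [f1 s12] := starI s1 s2; have [f2 _] := starI s2 s1.
  have FF : F `<=` F1 `&` F2 by exact: s12.2.
  split; first exact: tcone_is_face.
  by apply: tcone_is_face => //; rewrite setIC.
- by apply/seteqP; split=> // z _; have [F' sF' Fz] := tcone_cover z;
    exists (tcone F') => //; exists F'.
Qed.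

End Star.

(** * Identification of [Fan] with the tangent cones *)

Lemma nbhs_scale (R : realType) d (p v : 'rV[R]_d) (U : set 'rV[R]_d) :
  nbhs p U -> exists2 s, 0 < s & forall r, 0 <= r <= s -> U (p + r *: v).
Proof.
move=> /nbhs_rVP[q q0 qU]; pose M := \sum_j `|v 0 j|.
have M0 : 0 < 1 + M by rewrite ltr_pwDl // sumr_ge0.
exists (q / (1 + M)) => [|r /andP[r0 rs]]; first exact: divr_gt0.
apply: qU => j; rewrite mxE normrM ger0_norm //.
have vM : `|v 0 j| < 1 + M.
  by rewrite ltr_pwDl // /M (bigD1 j) //= lerDl sumr_ge0.
have [->|r1] := eqVneq r 0; first by rewrite mul0r.
apply: lt_le_trans (_ : r * (1 + M) <= _); last by rewrite -ler_pdivlMr.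
by rewrite ltr_pM2l // lt_def r1.
Qed.

Lemma gap_exists (R : realType) n (a : 'I_n -> R) :
  exists2 m, 0 < m & forall i, a i != 0 -> m <= `|a i|.
Proof.
(* The default 1 covers the case where all values vanish. *)
exists (\big[Num.min/1]_(i | a i != 0) `|a i|) => [|i ai].
  by apply: lt_bigmin => // i; rewrite normr_gt0.
exact: bigmin_le_cond.
Qed.

Section FanCone.
Variables (R : realType) (d k : nat) (P T F : set 'rV[R]_d).
Hypothesis pP : polytope P.
Hypothesis TP : face_to_face_tiling P T.
Hypothesis FT : tiling_face P T F.
Variables (E : 'M[R]_(k, d)) (Q : 'M[R]_(d, k)) (x0 : 'rV[R]_d).
Hypothesis EQ : orth_coords (lin F) E Q.
Hypothesis rx0 : relint F x0.

Let star' := star P T F.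
Let p := x0 *m Q *m E.

(** The tangent cone carried back to the orthogonal complement of [lin F], with apex at the
    projection [p] of [F]. *)
Definition fan_cone (F' : set 'rV[R]_d) : set 'rV[R]_d :=
  [set y | exists2 z, tcone E x0 F' z & y = p + z *m E].

Lemma fan_cone_sub F1 F2 :
  fan_cone F1 `<=` fan_cone F2 <-> tcone E x0 F1 `<=` tcone E x0 F2.
Proof.
split=> [F12 z F1z|F12 _ [z F1z ->]]; last by exists z => //; exact: F12.
have [|z' F2z /addrI/(congr1 (mulmx^~ Q))] := F12 (p + z *m E); first by exists z.
by rewrite !(coordsK EQ) => ->.
Qed.

Let oprojE u : oproj (lin F) u = u *m Q *m E.
Proof. by case: EQ. Qed.

Lemma oproj_base : oproj (lin F) @` F = [set p].
Proof.
have [Fx0 _] := rx0; apply/seteqP; split=> [_ [u Fu <-]|_ ->]; last first.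
  by exists x0 => //; rewrite oprojE.
rewrite /= oprojE; apply/eqP; rewrite -subr_eq0 -!mulmxBl.
by rewrite (coords_lin EQ) ?mul0mx // sub_lin.
Qed.

Lemma fan_cone_orth F' y : fan_cone F' y -> (y <= orthc (lin F))%MS.
Proof. by move=> [z _ ->]; rewrite -mulmxDl; exact: coords_orth EQ _. Qed.

Lemma fan_cone_polyhedral F' : star' F' -> polyhedral_cone p (fan_cone F').
Proof.
move=> sF'; have [_ [n [v tE]]] := tcone_polyhedral pP TP FT EQ rx0 sF'.
split.
  have [c [c0 tF]] := tcone_face E rx0 sF' (fun _ Fx => Fx) (star_base pP TP FT sF').
  split; first by exists p.
  exists c, (dotv c p); split=> [_ [z /c0 cz ->]|]; first by rewrite dotvDr gerDl.
  apply/seteqP; split=> [_ ->|_ [[z Fz ->] /= /eqP]].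
    split=> //; exists 0; last by rewrite mul0mx addr0.
    exact: (tcone0 E rx0 sF').
  rewrite dotvDr -subr_eq0 addrAC subrr add0r => /eqP cz.
  have : tcone E x0 F z by rewrite tF.
  by rewrite (tcone_base FT EQ rx0) => ->; rewrite mul0mx addr0.
exists n, (fun i => v i *m E); rewrite /fan_cone tE.
have sumE (c : 'I_n -> R) :
    (0 + \sum_i c i *: v i) *m E = \sum_i c i *: (v i *m E).
  by rewrite add0r mulmx_suml; apply: eq_bigr => i _; rewrite scalemxAl.
apply/seteqP; split=> [_ [_ [c [c0 ->]] ->]|_ [c [c0 ->]]].
  by exists c; rewrite sumE.
by exists (0 + \sum_i c i *: v i); [exists c|rewrite sumE].
Qed.

(* The functional exposing [F] in [F'] bounds the coefficients of a small vector
   of the cone with respect to its generators. *)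
Lemma fan_cone_germ F' : star' F' -> exists2 U, nbhs p U &
  (oproj (lin F) @` F') `&` U = fan_cone F' `&` U.
Proof.
move=> sF'; have [Fx0 _] := rx0.
have [c [c0 tF]] := tcone_face E rx0 sF' (fun _ Fx => Fx) (star_base pP TP FT sF').
have /polytopeP[n [W FW]] := star_polytope pP sF'.
pose w i := (row i W - x0) *m Q; pose a i := dotv c (w i *m E).
have F'W i : F' (row i W) by rewrite FW; exact: hull_row.
have Cw i : tcone E x0 F' (w i) by exact: (tcone_proj pP EQ rx0 sF').
have [m m0 ma] := gap_exists a.
exists [set y | - m < dotv c (y - p)].
  have [K K0 KC] := mulmx_bound c^T.
  apply/nbhs_rVP; exists (m / (2 * K)); first by rewrite divr_gt0 // mulr_gt0.
  move=> u um /=; rewrite addrAC subrr add0r dotvE.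
  have mK : 0 <= m / (2 * K) by rewrite divr_ge0 ?ltW // mulr_gt0.
  have := KC u _ (fun j => ltW (um j)) mK 0; rewrite ler_norml => /andP[+ _].
  apply: lt_le_trans; rewrite ltrN2.
  have -> : K * (m / (2 * K)) = m / 2 by field; rewrite lt0r_neq0.
  by rewrite ltr_pdivrMr // ltr_pMr // ltr1n.
apply/seteqP; split=> y [].
  move=> [u F'u <-] yU; split=> //; exists ((u - x0) *m Q).
    exact: (tcone_proj pP EQ rx0 sF').
  by rewrite oprojE -mulmxDl -mulmxDl addrC subrK.
move=> [z Cz ->] /= yU; split=> //.
move: yU; rewrite /= addrAC subrr add0r => zm.
move: Cz; rewrite (tcone_gen pP EQ rx0 sF' FW) => -[b [b0 zE]].
have cz : dotv c (z *m E) = - \sum_i b i * `|a i|.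
  rewrite zE mulmx_suml dotv_sumr -sumrN; apply: eq_bigr => i _.
  by rewrite -scalemxAl dotvZr -/(w i) -/(a i) ler0_norm ?mulrN ?opprK // c0.
pose b' i := if a i == 0 then 0 else b i.
have b'0 i : 0 <= b' i by rewrite /b'; case: ifP.
have b'1 : \sum_i b' i <= 1.
  rewrite -(ler_pM2l m0) mulr1 mulr_sumr; move: zm; rewrite cz ltrN2 => /ltW.
  apply: le_trans; apply: ler_sum => i _; rewrite /b'.
  have [a0|a0] := eqVneq (a i) 0; first by rewrite mulr0 mulr_ge0.
  by rewrite mulrC ler_wpM2l // ma.
have Fx := @polytope_sum_sub _ _ _ _ _ _ _ (star_polytope pP sF') b'0 b'1 F'W
  (sF'.2 _ Fx0).
exists (\sum_i b' i *: row i W + (1 - \sum_i b' i) *: x0) => //.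
rewrite oprojE /p -mulmxDl; congr (_ *m E).
rewrite scalerBl scale1r addrCA mulmxDl; congr (_ + _).
rewrite scaler_suml -sumrB zE mulmx_suml; apply: eq_bigr => i _.
rewrite -scalerBr -scalemxAl /b' -/(w i).
case: eqVneq => // a0; suff -> : w i = 0 by rewrite !scaler0.
have : tcone E x0 F (w i) by rewrite tF.
by rewrite (tcone_base FT EQ rx0).
Qed.

Lemma FanE : Fan P T F = fan_cone @` star'.
Proof.
have [Fx0 _] := rx0; apply/seteqP; split=> C; last first.
  move=> [F' sF' <-]; exists p; split; [exact: oproj_base|
    exact: fan_cone_polyhedral|exact: fan_cone_orth|].
  exists F'; have [tF' FF'] := sF'; split=> //.
  exact: fan_cone_germ.
move=> [p' [imF [_ [n [v CE]]] Co [F' [tF' FF' [U Up UE]]]]].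
have p'E : p' = p.
  have : (oproj (lin F) @` F) p by rewrite oproj_base.
  by rewrite imF => ->.
subst p'; have sF' : star' F' by [].
have Cp : C p.
  rewrite CE; exists (fun=> 0); split=> //.
  by rewrite big1 ?addr0 // => i _; rewrite scale0r.
(* Invariance under scaling from [p] lets the germ determine the whole cone. *)
have CZ y s : C (p + y) -> 0 <= s -> C (p + s *: y).
  rewrite CE => -[c [c0 /addrI ->]] s0; exists (fun i => s * c i); split=> [i|].
    exact: mulr_ge0.
  by rewrite scaler_sumr; congr (_ + _); apply: eq_bigr => i _; rewrite scalerA.
exists F' => //; apply/seteqP; split=> y.
  move=> [z [e e0 F'z] ->].
  have [s s0 sU] := nbhs_scale (z *m E) Up; pose r := Num.min e s.
  have r0 : 0 < r by rewrite lt_min e0.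
  have F'r : F' (x0 + r *: (z *m E)).
    by apply: (tcone_small pP rx0 sF' F'z); rewrite ltW //= ge_min lexx.
  have Ur : U (p + r *: (z *m E)).
    by apply: sU; rewrite ltW //= ge_min lexx orbT.
  have : (C `&` U) (p + r *: (z *m E)).
    rewrite -UE; split=> //; exists (x0 + r *: (z *m E)) => //.
    by rewrite oprojE !mulmxDl -!scalemxAl (coordsK EQ).
  move=> [/(CZ _ r^-1)]; rewrite scalerA mulVf ?lt0r_neq0 // scale1r.
  by move=> + _; apply; rewrite invr_ge0 ltW.
move=> Cy; pose u := y - p.
have yE : y = p + u by rewrite addrC subrK.
have uo : (u <= orthc (lin F))%MS.
  by rewrite addmx_sub ?eqmx_opp ?Co.
have [s s0 sU] := nbhs_scale u Up.
have Us : U (p + s *: u) by apply: sU; rewrite ltW //=.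
have [[x F'x xE] _] : ((oproj (lin F) @` F') `&` U) (p + s *: u).
  by rewrite UE; split=> //; apply: CZ (ltW s0); rewrite -yE.
exists (u *m Q); last by rewrite (coords_id EQ).
have -> : u *m Q = s^-1 *: ((x - x0) *m Q).
  have /(congr1 (mulmx^~ Q)) := xE; rewrite oprojE mulmxDl !(coordsK EQ).
  rewrite (mulmxBl x) => ->; rewrite addrAC subrr add0r -scalemxAl.
  by rewrite scalerK ?lt0r_neq0.
apply: (tconeZ rx0 sF'); last by rewrite invr_ge0 ltW.
exact: (tcone_proj pP EQ rx0 sF').
Qed.

End FanCone.

(* A face is the intersection of the tiles containing it, so their labels
   determine it. *)
Lemma star_index (R : realType) d (P T F : set 'rV[R]_d) (I : finType)
    (q : 'rV[R]_d -> I) :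
  polytope P -> adim P = d -> face_to_face_tiling P T -> tiling_face P T F ->
  (forall t t', T t -> T t' -> F `<=` tile P t -> F `<=` tile P t' ->
    q t = q t' -> t = t') ->
  exists h : {set I} -> set 'rV[R]_d, range h = star P T F.
Proof.
move=> pP dP TP FT qI.
pose G (A : {set I}) := [set y | forall t, T t -> F `<=` tile P t -> q t \in A ->
  tile P t y].
(* The default [F] keeps the values in the star for label sets that yield no face of it. *)
pose h A := if `[< star P T F (G A) >] then G A else F.
exists h; apply/seteqP; split=> [_ [A _ <-]|F' [tF' FF']].
  by rewrite /h; case: asboolP => //; split.
exists [set i | `[< exists t, [/\ T t, F' `<=` tile P t & q t = i] >]]%SET => //.
have GE : G [set i | `[< exists t, [/\ T t, F' `<=` tile P t & q t = i] >]]%SET = F'.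
  apply/seteqP; split=> y.
    move=> Gy; apply: (tiling_face_bigcap pP dP TP tF') => t Tt F't.
    apply: Gy => //; first by move=> x /FF'; exact: F't.
    by rewrite inE; apply/asboolP; exists t.
  move=> F'y t Tt Ft; rewrite inE => /asboolP[t' [Tt' F't' qt]].
  rewrite -(qI t' t) //; first exact: F't'.
  by move=> x /FF'; exact: F't'.
rewrite /h GE; case: asboolP => //; case; by split.
Qed.

(** * Inclusion patterns and the finite list of types *)

(** Indices may repeat cones: equal inclusion patterns identify the same indices on both sides,
    which gives both well-definedness and injectivity. *)
Lemma fan_isomorphic_index (R : realType) m n (I : finType)
    (A : I -> set 'rV[R]_m) (B : I -> set 'rV[R]_n) :
  (forall i j, A i `<=` A j <-> B i `<=` B j) ->
  fan_isomorphic (range A) (range B).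
Proof.
move=> AB.
(* All sets in this union coincide, so no representative index has to be chosen. *)
pose f C := \bigcup_(i in [set i | A i = C]) B i.
have fA i : f (A i) = B i.
  apply/seteqP; split=> [y [j /= ji]|y Biy]; last by exists i.
  by apply: (AB j i).1; rewrite ji.
exists f; split; last first.
  by move=> _ _ [i _ <-] [j _ <-]; rewrite !fA.
split.
- by move=> _ [i _ <-]; rewrite fA; exists i.
- move=> _ _ /set_mem[i _ <-] /set_mem[j _ <-]; rewrite !fA => /seteqP[ij ji].
  by apply/seteqP; split; apply/AB.
- by move=> _ [i _ <-]; exists (A i); [exists i|exact: fA].
Qed.

Theorem corollary3 (R : realType) (k : nat) :
  exists (N : nat) (C : 'I_N -> set (set 'rV[R]_k)),
    (forall i, complete_cone_fan (C i)) /\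
    forall (d : nat) (P T F : set 'rV[R]_d),
      parallelohedron P ->
      face_to_face_tiling P T ->
      tiling_face P T F ->
      (adim F + k)%N = d ->
      exists i, fan_isomorphic (Fan P T F) (C i).
Proof.
pose I : finType := {set tile_label R k}.
(* A type is recorded as a boolean inclusion table on the finite index type [I]. The list contains
   one fan for each table realized by some complete fan. *)
pose rep (r : {ffun I * I -> bool}) (B : I -> set 'rV[R]_k) :=
  complete_cone_fan (range B) /\ forall i j, r (i, j) <-> B i `<=` B j.
pose S := [set r | `[< exists B, rep r B >]]%SET.
have /choice[B BP] : forall i : 'I_#|S|, exists B, rep (enum_val i) B.
  by move=> i; have := enum_valP i; rewrite inE => /asboolP.
exists #|S|, (fun i => range (B i)); split=> [i|d P T F]; first by have [] := BP i.
move=> [pP dP _] TP FT dF.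
have [E [Q EQ]] := orth_coords_exists dF.
have pF := tiling_face_polytope pP FT.
have F0 : F !=set0 by have [t _ []] := FT.
have [x0 rx0] := polytope_relint pF F0.
have [q qI] := valence pP dP TP FT dF.
have [h hE] := star_index pP dP TP FT qI.
pose A (i : I) := tcone E x0 (h i).
have AE : range A = tcone E x0 @` star P T F.
  by rewrite -hE image_comp.
have FE : Fan P T F = range (fun i => fan_cone E Q x0 (h i)).
  by rewrite (FanE pP TP FT EQ rx0) -hE image_comp.
pose r := [ffun ij : I * I => `[< A ij.1 `<=` A ij.2 >]].
have rA : rep r A.
  split=> [|i j]; last by rewrite ffunE; split=> /asboolP.
  rewrite AE; apply: (tcone_fan pP dP TP FT EQ rx0).
  by rewrite -AE; exact: finite_image.
(* The tangent cones themselves realize the table [r], so the list contains a fan with the same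
   table. *)
have rS : r \in S by rewrite inE; apply/asboolP; exists A.
exists (enum_rank_in rS r); rewrite FE; apply: fan_isomorphic_index => i j.
have [_ rB] := BP (enum_rank_in rS r).
apply: (iff_trans (fan_cone_sub _ EQ _ _)); apply: iff_trans (rB i j).
by rewrite enum_rankK_in // ffunE; split=> /asboolP.
Qed.
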